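(* Let $p>1$ and let $V:\mathbb{R}^n\to\mathbb{R}$ be an even, strictly convex, $p$-homogeneous function which is $C^3$ on $\mathbb{R}^n\setminus\{0\}$. Let $\Phi\in\mathcal{C}$ be a maximum point on $\mathcal{C}$ of the functional $$\mathcal{BS}_{p,V}(\Phi)=\int_{\mathbb{R}^n} e^{-\Phi(x)}\,dx\,\Bigl(\int_{\mathbb{R}^n} e^{-\frac{1}{p-1}\Phi^*(\nabla V(x))}\,dx\Bigr)^{p-1},$$ and suppose that $\Phi(0)=0$. Then $\Phi$ is $p$-homogeneous.
   Context: $\mathcal{C}$ is the class of lower semicontinuous, even, convex functions $\Phi:\mathbb{R}^n\to\mathbb{R}\cup\{+\infty\}$ such that $\{\Phi<\infty\}$ has non-empty interior and $\lim_{|x|\to\infty}\Phi(x)=+\infty$. $\Phi^*(y)=\sup_x(\langle x,y\rangle-\Phi(x))$ is the Legendre transform. A function $f$ is $p$-homogeneous if $f(tx)=t^pf(x)$ for all $t\ge0$ and $x\in\mathbb{R}^n$. *)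

(* Defs.v *)
From HB Require Import structures.
From mathcomp Require Import all_boot all_order all_algebra.
From mathcomp Require Import all_classical all_reals all_analysis.

Set Implicit Arguments.
Unset Strict Implicit.
Unset Printing Implicit Defensive.

Import Order.TTheory GRing.Theory Num.Theory.
Import numFieldNormedType.Exports.

Local Open Scope classical_set_scope.
Local Open Scope ring_scope.

(* The library's norm on 'rV[R]_n is the sup norm, hence the explicit Euclidean
   structure. *)
Definition dotprod (R : realType) (n : nat) (x y : 'rV[R]_n) : R :=
  \sum_(i < n) x 0 i * y 0 i.

Definition enorm (R : realType) (n : nat) (x : 'rV[R]_n) : R :=
  Num.sqrt (dotprod x x).

(* The filter |x| -> +oo. *)
Definition enorm_infty (R : realType) (n : nat) : set_system 'rV[R]_n :=
  filter_from [set: R] (fun r => [set x : 'rV[R]_n | r < enorm x]).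

(* ['rV[R]_n] carries the product sigma-algebra of n copies of the Borel
   sigma-algebra of R, that is, the Borel sigma-algebra of R^n; the library
   equips [n.-tuple R] in the same way. *)
Section measurable_rV.
Context (R : realType) (n : nat).

Let coors : 'I_n -> 'rV[R]_n -> R := fun i x => x 0 i.

Let rV_set0 : g_sigma_preimage coors set0.
Proof. exact: sigma_algebra0. Qed.

Let rV_setC A : g_sigma_preimage coors A -> g_sigma_preimage coors (~` A).
Proof. exact: sigma_algebraC. Qed.

Let rV_bigcup (F : _^nat) : (forall i, g_sigma_preimage coors (F i)) ->
  g_sigma_preimage coors (\bigcup_i (F i)).
Proof. exact: sigma_algebra_bigcup. Qed.

HB.instance Definition _ := @isMeasurable.Build
  default_measure_display 'rV[R]_n
  (g_sigma_preimage coors) rV_set0 rV_setC rV_bigcup.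
End measurable_rV.

Section lebesgue_rV.
Context (R : realType).

Definition consrV (n : nat) (xy : R * 'rV[R]_n) : 'rV[R]_n.+1 :=
  row_mx xy.1%:M xy.2.

Lemma measurable_coord (n : nat) (i : 'I_n) :
  measurable_fun [set: 'rV[R]_n] (fun x => x 0 i : R).
Proof.
move=> _ A mA; rewrite setTI.
case: n i => [[] //|n] i; apply: sub_sigma_algebra.
rewrite -bigcup_mkord_ord; exists i; first exact: ltn_ord.
by exists A => //; rewrite setTI inord_val.
Qed.

Lemma measurable_fun_rV d (T : measurableType d) (n : nat)
    (f : T -> 'rV[R]_n) :
  (forall i, measurable_fun [set: T] (fun x => f x 0 i : R)) ->
  measurable_fun [set: T] f.
Proof.
move=> mf _ A mA; rewrite setTI; move: A mA.
apply: smallest_sub => /=.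
- split => [|A mA|F mF].
  + by rewrite preimage_set0.
  + by rewrite setTD preimage_setC; apply: measurableC.
  + by rewrite preimage_bigcup; apply: bigcup_measurable => k _; exact: mF.
- case: n f mf => [|n] f mf; first by rewrite big_ord0.
  rewrite -bigcup_mkord_ord; apply: bigcup_sub => i _ _ [B mB <-] /=.
  by rewrite setTI -[X in measurable X]setTI; exact: mf.
Qed.

Lemma measurable_consrV (n : nat) :
  measurable_fun [set: measurableTypeR R * 'rV[R]_n] (@consrV n).
Proof.
apply: measurable_fun_rV => i; rewrite /consrV.
under eq_fun do rewrite mxE.
case: (@fintype.split 1 n i) => k.
- under eq_fun do rewrite mxE ord1 eqxx mulr1n.
  exact: measurable_fst.
- by apply: (measurableT_comp (measurable_coord k)); exact: measurable_snd.
Qed.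

Lemma consrV0 (n : nat) (x : R) (y : 'rV[R]_n) : consrV (x, y) 0 ord0 = x.
Proof.
have -> : ord0 = @lshift 1 n ord0 by exact: val_inj.
by apply: (etrans (@row_mxEl _ _ 1 n _ _ _ _)); rewrite mxE eqxx.
Qed.

Lemma consrVS (n : nat) (x : R) (y : 'rV[R]_n) (i : 'I_n) :
  consrV (x, y) 0 (lift ord0 i) = y 0 i.
Proof.
have -> : lift ord0 i = @rshift 1 n i by exact: val_inj.
exact: (@row_mxEr _ _ 1 n).
Qed.

Section cons_measure.
Variables (n : nat) (m : {sigma_finite_measure set 'rV[R]_n -> \bar R}).

Definition cons_measure : set 'rV[R]_n.+1 -> \bar R :=
  pushforward (@lebesgue_measure R \x m)%E (@consrV n).

Let mf := @measurable_consrV n.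

Let cons_measure0 : cons_measure set0 = 0%E.
Proof. exact: measure0. Qed.

Let cons_measure_ge0 A : (0 <= cons_measure A)%E.
Proof. exact: measure_ge0. Qed.

Let cons_measure_sigma_additive : semi_sigma_additive cons_measure.
Proof. exact: measure_semi_sigma_additive. Qed.

HB.instance Definition _ := isMeasure.Build _ _ _ cons_measure
  cons_measure0 cons_measure_ge0 cons_measure_sigma_additive.

Let cons_measure_sigma_finite : sigma_finite setT cons_measure.
Proof.
pose g (z : 'rV[R]_n.+1) : R * 'rV[R]_n := (z 0 ord0, \row_i z 0 (lift ord0 i)).
have consK : cancel (@consrV n) g.
  by move=> [x y]; rewrite /g consrV0; congr pair;
    apply/rowP => i; rewrite mxE consrVS.
have mg : measurable_fun [set: 'rV[R]_n.+1] g.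
  apply: measurable_fun_pair; first exact: measurable_coord.
  apply: measurable_fun_rV => i; under eq_fun do rewrite mxE.
  exact: measurable_coord.
have /sigma_finiteP[F [TF ndF Foo]] := sigma_finiteT (@lebesgue_measure R).
have /sigma_finiteP[G [TG ndG Goo]] := sigma_finiteT m.
exists (fun k => g @^-1` (F k `*` G k)) => [|k].
  apply/esym/seteqP; split=> // z _.
  have [i _ Fi] : (\bigcup_i F i) (g z).1 by rewrite -TF.
  have [j _ Gj] : (\bigcup_i G i) (g z).2 by rewrite -TG.
  exists (maxn i j) => //; split.
  - by move: Fi; exact/subsetPset/ndF/leq_maxl.
  - by move: Gj; exact/subsetPset/ndG/leq_maxr.
have [mFk Fkoo] := Foo k; have [mGk Gkoo] := Goo k; split.
  by rewrite -[X in measurable X]setTI; apply: mg => //; exact: measurableX.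
rewrite /cons_measure /pushforward -comp_preimage.
rewrite (_ : g \o _ = id) ?preimage_id; last by apply/funext => z; exact: consK.
by rewrite product_measure1E// lte_mul_pinfty// ge0_fin_numE.
Qed.

HB.instance Definition _ := Measure_isSigmaFinite.Build _ _ _ cons_measure
  cons_measure_sigma_finite.

End cons_measure.

(* n-dimensional Lebesgue measure, as the n-fold product measure. *)
Fixpoint lebesgue_rV (n : nat) : {sigma_finite_measure set 'rV[R]_n -> \bar R} :=
  if n is k.+1 then cons_measure (lebesgue_rV k) else dirac (0 : 'rV[R]_0).

Lemma lebesgue_rV_box (n : nat) (A : 'I_n -> set R) :
  (forall i, measurable (A i)) ->
  lebesgue_rV n [set x : 'rV[R]_n | forall i, A i (x 0 i)] =
  (\prod_(i < n) lebesgue_measure (A i))%E.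
Proof.
elim: n A => [|n IH] A mA.
  by rewrite big_ord0 /= diracE mem_set//= => -[].
have mB : measurable [set y : 'rV[R]_n | forall i, A (lift ord0 i) (y 0 i)].
  rewrite (_ : mkset _ = \bigcap_(i : 'I_n)
      ((fun y : 'rV[R]_n => y 0 i : R) @^-1` A (lift ord0 i))).
    apply: fin_bigcap_measurable => [|i _]; first exact: finite_finset.
    rewrite -[X in measurable X]setTI.
    exact: measurable_coord.
  by apply/seteqP; split=> [y Ay i _|y Ay i]; apply: Ay.
rewrite big_ord_recl -IH//= /cons_measure /pushforward -product_measure1E//;
  last exact: mA.
congr (product_measure1 _ _ _); apply/seteqP; split=> -[x y] /=.
- move=> Axy; split=> [|i].
    by have := Axy ord0; rewrite consrV0.
  by have := Axy (lift ord0 i); rewrite consrVS.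
- by move=> [Ax Ay] i; case: (unliftP ord0 i) => [j|] ->; rewrite ?consrVS ?consrV0.
Qed.
End lebesgue_rV.

Definition grad (R : realType) (n : nat) (f : 'rV[R]_n -> R) (x : 'rV[R]_n) :
    'rV[R]_n :=
  \row_(i < n) 'D_(delta_mx 0 i) f x.

(* f is C^k on the open set U: all partial derivatives up to order k exist and
   are continuous on U. *)
Fixpoint Ck_on (R : realType) (n : nat) (k : nat) (U : set 'rV[R]_n)
    (f : 'rV[R]_n -> R) : Prop :=
  (forall x, U x -> {for x, continuous f}) /\
  if k is k'.+1 then
    forall i : 'I_n, (forall x, U x -> derivable f x (delta_mx 0 i)) /\
      Ck_on k' U (fun x => 'D_(delta_mx 0 i) f x)
  else True.

Definition strictly_convex (R : realType) (n : nat) (f : 'rV[R]_n -> R) : Prop :=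
  forall (x y : 'rV[R]_n) (t : R), x != y -> 0 < t -> t < 1 ->
    f (t *: x + (1 - t) *: y) < t * f x + (1 - t) * f y.

(* For extended-valued functions, 0 * +oo = 0. *)
Definition econvex (R : realType) (n : nat) (f : 'rV[R]_n -> \bar R) : Prop :=
  forall (x y : 'rV[R]_n) (t : R), 0 <= t -> t <= 1 ->
    (f (t *: x + (1 - t) *: y)%R <= t%:E * f x + (1 - t)%:E * f y)%E.

Definition even_fun (R : realType) (n : nat) (T : Type) (f : 'rV[R]_n -> T) :
    Prop :=
  forall x, f (- x) = f x.

Definition p_homogeneous (R : realType) (n : nat) (p : R)
    (f : 'rV[R]_n -> \bar R) : Prop :=
  forall (t : R) (x : 'rV[R]_n), 0 <= t -> f (t *: x) = ((t `^ p)%:E * f x)%E.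

Record classC (R : realType) (n : nat) (Phi : 'rV[R]_n -> \bar R) : Prop := {
  classC_gtNy : forall x, (-oo < Phi x)%E;
  classC_lsc : lower_semicontinuous Phi;
  classC_even : even_fun Phi;
  classC_convex : econvex Phi;
  classC_domain : [set x | (Phi x < +oo)%E]° !=set0;
  classC_infty : Phi x @[x --> @enorm_infty R n] --> +oo%E }.

Definition legendre (R : realType) (n : nat) (Phi : 'rV[R]_n -> \bar R)
    (y : 'rV[R]_n) : \bar R :=
  ereal_sup [set ((dotprod x y)%:E - Phi x)%E | x in [set: 'rV[R]_n]].

Definition BS (R : realType) (n : nat) (p : R) (V : 'rV[R]_n -> R)
    (Phi : 'rV[R]_n -> \bar R) : \bar R :=
  ((\int[lebesgue_rV R n]_x expeR (- Phi x)) *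
   (\int[lebesgue_rV R n]_x
      expeR (- (((p - 1)^-1)%R%:E * legendre Phi (grad V x)))) `^ (p - 1))%E.

(* Main.v *)
Require Import Defs.
From mathcomp Require Import all_boot all_order all_algebra.
From mathcomp Require Import all_classical all_reals all_analysis.
From mathcomp Require Import measurable_realfun.
From mathcomp Require Import ring lra.
Import Order.TTheory GRing.Theory Num.Theory.
Import numFieldNormedType.Exports.
Local Open Scope classical_set_scope.
Local Open Scope ring_scope.

(* Write F(s) and G(s) for the volumes of the sublevel sets at height s of Phi and
   of y |-> Phi^*(grad V(y)) / (p - 1). Given t > 0, let N be the support function
   of {w | Phi^*(p t w) <= (p - 1) t}. Comparing Phi with the competitor t N^p turns
   maximality into
     F(s) G(t)^(p-1) <= c ((s + (p - 1) t) / p)^n   for all s, t > 0.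
   By the layer cake formula, c is such that the normalised densities e^{-s} F(s),
   e^{-s} G(s) and e^{-s} s^{n/p} satisfy the hypothesis of the one-dimensional
   Prekopa-Leindler inequality with weights 1/p and 1 - 1/p and equality in its
   conclusion. The transport proof of that inequality then forces equality above
   for s = t, hence {N < 1} is contained in {Phi <= t}. Consequently Phi(x) <= s
   implies Phi(r x) <= t as soon as r < p t / (s + (p - 1) t), and iterating this
   with many steps close to the identity gives Phi(r x) <= r^p Phi(x). *)

(** The heights in the competitor are those of a [p]-homogeneous function: where such a function
    equals t, Euler's relation gives <x, grad> = p t, so its Legendre transform at the gradient is
    (p - 1) t. Homogeneity turns both integrals of the competitor into multiples of volumes of
    sublevel sets. Each competitor controls one height only; equality in Prekopa-Leindler is what
    makes the comparisons sharp at all heights at once. The transport argument needs distribution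
    functions with a derivative at every point; F and G are continuous because Phi and Phi^*
    contract at least by the factor l when their argument is scaled by l <= 1. Finally, with tau = t
    / s, the one-step factor p tau / (1 + (p - 1) tau) is at most tau^(1/p), but both have
    logarithmic derivative 1/p at tau = 1, so m steps of ratio tau^(1/m) lose only O(1/m) on the
    logarithmic scale. *)

(** * Lebesgue measure on row vectors: open sets, dilations, bounded sets *)

Section lebesgue_rV_theory.
Context {R : realType}.

(** The sigma-algebra is generated by the coordinates, so openness has to become a countable union:
    the boxes with rational centre and radius [1 / (k + 1)] contained in [U] exhaust it. *)
Lemma open_measurable_rV (n : nat) (U : set 'rV[R]_n) : open U -> measurable U.
Proof.
move=> oU.
pose box (q : 'rV[rat]_n * nat) : set 'rV[R]_n :=
  [set x | forall i, `|x 0 i - ratr (q.1 0 i)| < q.2.+1%:R^-1].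
have mbox q : measurable (box q).
  rewrite (_ : box q = \bigcap_(i : 'I_n)
      ((fun x : 'rV[R]_n => x 0 i : R) @^-1`
        (ball (ratr (q.1 0 i) : R) (q.2.+1%:R^-1 : R)))).
    apply: fin_bigcap_measurable => [|i _]; first exact: finite_finset.
    rewrite -[X in measurable X]setTI; apply: measurable_coord => //.
    by apply: open_measurable; exact: ball_open.
  apply/seteqP; split=> [x xq i _|x xq i].
    by rewrite /= /ball /= distrC.
  by have := xq i I; rewrite /= /ball /= distrC.
rewrite (_ : U = \bigcup_(q in [set q | box q `<=` U]) box q).
  rewrite bigcup_mkcond; apply: countable_bigcupT_measurable => // q.
  by case: ifPn.
apply/seteqP; split=> [x Ux|x [q qU xq]]; last exact: qU.
have /nbhs_ballP[e /= e0 eU] : nbhs x U by exact: open_nbhs_nbhs.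
(* The rational centre is within [1 / (k + 1)] of [x], so points of the box are within twice that of
   [x]. *)
have [k ke] : exists k : nat, k.+1%:R^-1 < e / 2.
  have := @near_infty_natSinv_lt R (PosNum (divr_gt0 e0 (ltr0Sn _ 1))).
  by case=> k _ kP; exists k; apply: kP => /=.
have k0 : 0 < k.+1%:R^-1 :> R by rewrite invr_gt0.
have [dl dlE] : exists dl : R, dl = k.+1%:R^-1 by exists k.+1%:R^-1.
rewrite -dlE in ke k0.
have /choice[q qP] : forall i : 'I_n, exists q : rat,
    `|x 0 i - ratr q| < dl.
  move=> i; have : x 0 i - dl < x 0 i + dl by lra.
  move=> /rat_in_itvoo[q].
  by rewrite in_itv/= => /andP[q1 q2]; exists q; rewrite ltr_norml; lra.
exists (\row_i q i, k); last by move=> i /=; rewrite mxE -dlE.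
move=> y /= yq; apply: eU; split=> // i j; rewrite /ball /= (ord1 i).
have := yq j; rewrite /= mxE -dlE => yqj.
rewrite (_ : x 0 j - y 0 j = (x 0 j - ratr (q j)) - (y 0 j - ratr (q j))).
  by rewrite (le_lt_trans (ler_normB _ _))//; have := qP j; lra.
by ring.
Qed.

Lemma lsc_measurable_rV (n : nat) (f : 'rV[R]_n -> \bar R) :
  lower_semicontinuous f -> measurable_fun [set: 'rV[R]_n] f.
Proof.
move=> scf; apply: (measurability _ (ErealGenOInfty.measurableE R)).
move=> /= _ [_ [a ->]] <-; apply: measurableI => //; apply: open_measurable_rV.
by rewrite preimage_itvoy; move/lower_semicontinuousP : scf; exact.
Qed.

(** Uniqueness of Lebesgue measure: [t] times the image measure gives half-open intervals their
    length. *)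
Lemma lebesgue_measure_dilate (t : R) (A : set R) : 0 < t -> measurable A ->
  lebesgue_measure (( *%R t) @^-1` A) = (t^-1%:E * lebesgue_measure A)%E.
Proof.
move=> t0 mA.
have mt : measurable_fun setT (( *%R t) : measurableTypeR R -> measurableTypeR R).
  exact: measurable_funM.
have t1 : 0 <= t by exact: ltW.
pose m := mscale (NngNum t1) (pushforward (@lebesgue_measure R)
  (( *%R t) : measurableTypeR R -> measurableTypeR R)).
have -> : lebesgue_measure A = m mt A.
  apply: lebesgue_measure_unique => //= _ [[a b]] _ <-.
  transitivity (t%:E * lebesgue_measure (( *%R t) @^-1` `]a, b]))%E => //.
  rewrite (_ : _ @^-1` _ = `]t^-1 * a, t^-1 * b]%classic); last first.
    apply/seteqP; split=> x /=; rewrite !in_itv/=.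
      by rewrite ltr_pdivrMl// ler_pdivlMl.
    by rewrite ltr_pdivrMl// ler_pdivlMl.
  rewrite !lebesgue_measure_itv/= !lte_fin ltr_pM2l ?invr_gt0//.
  case: ifPn => _; last by rewrite mule0.
  rewrite -!EFinD -EFinM; congr (_%:E); field; exact: lt0r_neq0.
rewrite /m /mscale /pushforward /= muleA -EFinM mulVf ?mul1e//.
exact: lt0r_neq0.
Qed.

Lemma measurable_scale_rV (n : nat) (t : R) :
  measurable_fun [set: 'rV[R]_n] (fun x : 'rV[R]_n => t *: x).
Proof.
apply: measurable_fun_rV => i; under eq_fun do rewrite mxE.
by apply: measurable_funM => //; exact: measurable_coord.
Qed.

(** Induction on the dimension: the rescaled image of the product measure agrees with the product
    measure on rectangles, which determine it. *)
Lemma lebesgue_rV_dilate (n : nat) (t : R) (A : set 'rV[R]_n) :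
  0 < t -> measurable A ->
  lebesgue_rV R n ((fun x => t *: x) @^-1` A) =
  ((t^-1 ^+ n)%:E * lebesgue_rV R n A)%E.
Proof.
move=> t0; elim: n A => [|n IH] A mA.
  rewrite expr0 mul1e; congr (lebesgue_rV R 0 _).
  by apply/seteqP; split=> x /=; rewrite [t *: x]thinmx0 [x]thinmx0.
pose S2 (z : measurableTypeR R * 'rV[R]_n) : measurableTypeR R * 'rV[R]_n :=
  (t * z.1, t *: z.2).
have mS2 : measurable_fun setT S2.
  apply: measurable_fun_pair => /=.
    by apply: measurable_funM => //; exact: measurable_fst.
  apply: (measurableT_comp (measurable_scale_rV n t)); exact: measurable_snd.
have t1 : 0 <= t ^+ n.+1 by exact/exprn_ge0/ltW.
pose m := mscale (NngNum t1)
  (pushforward (@lebesgue_measure R \x lebesgue_rV R n)%E S2).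
have mE B : measurable B ->
    (@lebesgue_measure R \x lebesgue_rV R n)%E B = m mS2 B.
  apply: product_measure_unique => X Y mX mY.
  transitivity ((t ^+ n.+1)%:E *
    (@lebesgue_measure R \x lebesgue_rV R n) (S2 @^-1` (X `*` Y)))%E => //.
  rewrite (_ : S2 @^-1` _ = (( *%R t) @^-1` X) `*` ((fun x => t *: x) @^-1` Y))//.
  have mX' : measurable (( *%R t) @^-1` X).
    have mt : measurable_fun setT (( *%R t) : measurableTypeR R -> measurableTypeR R).
      exact: measurable_funM.
    by rewrite -[X in measurable X]setTI; exact: mt.
  have mY' : measurable ((fun x => t *: x) @^-1` Y).
    by rewrite -[X in measurable X]setTI; exact: measurable_scale_rV.
  rewrite product_measure1E//= lebesgue_measure_dilate// IH//.
  have scaleK (a b c : R) (u v : \bar R) : c * a * b = 1 ->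
      (c%:E * ((a%:E * u) * (b%:E * v)) = u * v)%E.
    by move=> abc; rewrite -muleA (muleCA u) !muleA -!EFinM abc mul1e.
  by apply: scaleK; rewrite exprSr mulfK ?lt0r_neq0// exprVn divff// expf_neq0// lt0r_neq0.
have mcA : measurable (@consrV R n @^-1` A).
  by rewrite -[X in measurable X]setTI; exact: measurable_consrV.
have {}mE : (@lebesgue_measure R \x lebesgue_rV R n)%E (@consrV R n @^-1` A) =
    ((t ^+ n.+1)%:E *
      (@lebesgue_measure R \x lebesgue_rV R n) (S2 @^-1` (@consrV R n @^-1` A)))%E.
  exact: (mE _ mcA).
rewrite [in RHS]/= /cons_measure /pushforward mE muleA -EFinM exprVn mulVf; last first.
  by rewrite expf_neq0// lt0r_neq0.
rewrite mul1e /= /cons_measure /pushforward; congr (product_measure1 _ _ _).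
have consZ x y : consrV (t * x, t *: y) = t *: consrV (x, y) :> 'rV[R]_n.+1.
  apply/rowP => i; case: (unliftP ord0 i) => [j|] ->.
    by rewrite [RHS]mxE !consrVS mxE.
  by rewrite [RHS]mxE !consrV0.
by apply/seteqP; split=> -[x y]; rewrite /preimage /S2 /= consZ.
Qed.

Lemma measurable_box_rV (n : nat) (A : 'I_n -> set R) :
  (forall i, measurable (A i)) ->
  measurable [set x : 'rV[R]_n | forall i, A i (x 0 i)].
Proof.
move=> mA; rewrite (_ : mkset _ = \bigcap_(i : 'I_n)
    ((fun y : 'rV[R]_n => y 0 i : R) @^-1` A i)).
  apply: fin_bigcap_measurable => [|i _]; first exact: finite_finset.
  by rewrite -[X in measurable X]setTI; exact: measurable_coord.
by apply/seteqP; split=> [y Ay i _|y Ay i]; apply: Ay.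
Qed.

Lemma lebesgue_rV_open_gt0 (n : nat) (U : set 'rV[R]_n) :
  open U -> U !=set0 -> (0 < lebesgue_rV R n U)%E.
Proof.
move=> oU [x Ux].
have /nbhs_ballP[e /= e0 eU] : nbhs x U by exact: open_nbhs_nbhs.
pose A (i : 'I_n) : set R := `]x 0 i - e, x 0 i + e[%classic.
have mA i : measurable (A i) by exact: measurable_itv.
apply: (@lt_le_trans _ _
    (lebesgue_rV R n [set y : 'rV[R]_n | forall i, A i (y 0 i)])).
  rewrite lebesgue_rV_box// (eq_bigr (fun=> (e + e)%:E)) => [|i _].
    by rewrite prodEFin lte_fin; apply: prodr_gt0 => i _; exact: addr_gt0.
  rewrite /A lebesgue_measure_itv/= lte_fin ifT; last by lra.
  by rewrite -EFinD; congr (_%:E); ring.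
apply: le_measure; rewrite ?inE; [exact: measurable_box_rV|
  exact: open_measurable_rV|].
move=> y Ay; apply: eU; split=> // i j; rewrite /ball /= (ord1 i).
by have := Ay j; rewrite /A /= in_itv/= ltr_norml => /andP[? ?]; lra.
Qed.

Lemma lebesgue_rV_bounded_lty (n : nat) (M : R) (A : set 'rV[R]_n) :
  measurable A -> (forall x, A x -> forall i, `|x 0 i| <= M) ->
  (lebesgue_rV R n A < +oo)%E.
Proof.
move=> mA AM.
pose B (i : 'I_n) : set R := `[- M, M]%classic.
have mB i : measurable (B i) by exact: measurable_itv.
apply: (@le_lt_trans _ _
    (lebesgue_rV R n [set y : 'rV[R]_n | forall i, B i (y 0 i)])).
  apply: le_measure; rewrite ?inE//; first exact: measurable_box_rV.
  by move=> x /AM xM i; rewrite /B /= in_itv/= -ler_norml.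
rewrite lebesgue_rV_box// (eq_bigr (fun=> (if - M < M then M + M else 0)%:E)).
  by rewrite prodEFin ltry.
move=> i _; rewrite /B lebesgue_measure_itv/= lte_fin.
by case: ifPn => // _; rewrite -EFinD opprK.
Qed.

End lebesgue_rV_theory.

(** * Exponential integrals and the layer cake formula *)

Lemma integral_expRM_itvcy (R : realType) (c r : R) : (0 < c)%R ->
  (\int[lebesgue_measure]_(s in `[r, +oo[) (expR (- (c * s)))%:E =
  (expR (- (c * r)) / c)%:E)%E.
Proof.
move=> c0.
have D x : is_derive x (1 : R)%R (fun s : R => - (expR (- (c * s)) / c))%R
    (expR (- (c * x))).
  apply: is_derive_eq; rewrite /GRing.scale /=; field; exact: lt0r_neq0.
have C x : {for x, continuous (fun s : R => expR (- (c * s)))}.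
  apply: continuous_comp; last exact: continuous_expR.
  by apply: continuousN; apply: continuousM => //; exact: cst_continuous.
rewrite (@ge0_continuous_FTC2y _ _ (fun s => - (expR (- (c * s)) / c))%R _ 0%R).
- by rewrite -EFinB opprK add0r.
- by move=> x _; exact: expR_ge0.
- by apply: continuous_subspaceT => x; exact: C.
- rewrite -[X in _ --> X]oppr0; apply: cvgN.
  rewrite -[X in _ --> X](mul0r c^-1); apply: cvgMl.
  apply: (@cvg_comp _ _ _ (fun s => c * s)%R (fun y => expR (- y))%R _ +oo%R).
    exact: gt0_cvgMry.
  exact: cvgr_expR.
- by move=> x _; apply: ex_derive.
- by apply: cvgN; apply: cvgMl; apply: cvg_at_right_filter; exact: C.
- by move=> x _; rewrite derive1E; apply: derive_val.
Qed.

Section layer_cake.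
Context d (T : measurableType d) (R : realType).
Variable m : {sigma_finite_measure set T -> \bar R}.
Local Open Scope ereal_scope.

Lemma integral_expRN_itvcy (r : R) :
  \int[lebesgue_measure]_(s in `[r, +oo[) (expR (- s))%:E = (expR (- r))%:E.
Proof.
have := integral_expRM_itvcy R 1 r ltr01; rewrite mul1r divr1 => <-.
by apply: eq_integral => s _; rewrite mul1r.
Qed.

(** Tonelli for [expR (- s)] on the region [0 < s], [f x <= s]; where [f] is infinite the section is
    empty and the integrand [expeR (- f x)] is [0]. *)
Lemma layer_cake_expeR (f : T -> \bar R) :
  measurable_fun setT f -> (forall x, 0 <= f x) ->
  \int[m]_x expeR (- f x) =
  \int[lebesgue_measure]_(s in `]0%R, +oo[)
    ((expR (- s))%:E * m [set x | f x <= s%:E]).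
Proof.
move=> mf f0.
pose E : set (T * measurableTypeR R) := [set z | (0 < z.2)%R /\ f z.1 <= z.2%:E].
have mE : measurable E.
  apply: measurableI.
    rewrite [X in measurable X](_ : _ = setT `&` snd @^-1` `]0%R, +oo[%classic).
      by apply: measurable_snd => //; exact: measurable_itv.
    by rewrite setTI; apply/seteqP; split=> z /=; rewrite in_itv/= andbT.
  rewrite -[X in measurable X]setTI.
  apply: measurable_lee => //.
    by apply: (measurableT_comp mf); exact: measurable_fst.
  by apply/measurable_EFinP; exact: measurable_snd.
have mfs s : measurable [set x | f x <= s%:E].
  rewrite -[X in measurable X]setTI.
  by apply: emeasurable_fun_infty_c.
pose k (z : T * measurableTypeR R) : \bar R := (expR (- z.2) * \1_E z)%:E.
have k0 z : 0 <= k z by rewrite lee_fin mulr_ge0 ?expR_ge0.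
have mk : measurable_fun setT k.
  apply/measurable_EFinP; apply: measurable_funM; last exact: measurable_indic.
  apply: (measurableT_comp (@measurable_expR R)).
  by apply: measurable_funN; exact: measurable_snd.
transitivity (\int[m]_x \int[lebesgue_measure]_s k (x, s)).
  apply: eq_integral => x _.
  have kE (s : R) : k (x, s) = ((fun s : R => (expR (- s))%:E) \_
      [set s : R | (0 < s)%R /\ f x <= s%:E]) s.
    rewrite /k patchE indicE /=; have [xE|xE] := boolP (_ \in E).
      by rewrite inE in xE; rewrite mem_set// mulr1.
    by rewrite notin_setE in xE; rewrite memNset// mulr0.
  transitivity (\int[lebesgue_measure]_(s in [set s : R | (0 < s)%R /\ f x <= s%:E])
      (expR (- s))%:E); last first.
    by rewrite [LHS]integral_mkcond; apply: eq_integral => s _; rewrite kE.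
  have := f0 x; case: (f x) => [r| |//] r0 /=.
    rewrite -integral_expRN_itvcy.
    (* At [r = 0] the range of [s] is open at [0] while the integral runs over a closed half-line;
       the endpoint is a null set. *)
    move: r0; rewrite lee_fin le_eqVlt => /predU1P[<-|r0].
      rewrite -integral_itv_obnd_cbnd; last first.
        apply/measurable_EFinP; apply: measurable_funTS.
        apply: continuous_measurable_fun => z.
        by apply: continuous_comp; [exact: opp_continuous|exact: continuous_expR].
      congr (integral _ _ _); apply/seteqP; split=> s /=; rewrite in_itv/= lee_fin andbT.
        by move=> s0; split=> //; exact: ltW.
      by case.
    congr (integral _ _ _); apply/seteqP; split=> s /=; rewrite in_itv/= lee_fin andbT.
      by move=> rs; split=> //; exact: lt_le_trans rs.
    by case.
  rewrite (_ : mkset _ = set0) ?integral_set0//.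
  by apply/seteqP; split=> s //= -[].
rewrite (fubini_tonelli k mk k0).
rewrite [RHS]integral_mkcond; apply: eq_integral => s _.
rewrite patchE; case: ifPn; rewrite ?inE ?notin_setE/= in_itv/= andbT => s0.
  rewrite (eq_integral (fun x => (expR (- s))%:E * (\1_[set x | f x <= s%:E]%E x)%:E)).
    rewrite ge0_integralZl//=.
    - by rewrite integral_indic ?setIT.
    - by apply/measurable_EFinP; exact: measurable_indic.
  move=> x _; rewrite /k EFinM; congr (_ * _%:E); rewrite !indicE; congr ((_ : bool)%:R).
  by apply/idP/idP; rewrite !inE /E /=; [case|].
rewrite integral0_eq// => x _; rewrite /k indicE memNset ?mulr0//=.
by rewrite /E/= => -[].
Qed.

End layer_cake.

(** * Equality in the one-dimensional Prekopa-Leindler inequality, by transport *)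

Section prekopa_leindler_equality.
Context {R : realType}.

Lemma gt0_derive_lt (F dF : R -> R) :
  (forall x : R, 0 < x -> is_derive x 1 F (dF x)) -> (forall x : R, 0 < x -> 0 < dF x) ->
  forall x y : R, 0 < x -> x < y -> F x < F y.
Proof.
move=> FdF dF0 x y x0 xy.
have [c] : exists2 c, c \in `]x, y[%R & F y - F x = dF c * (y - x).
  apply: MVT => //.
    move=> z; rewrite in_itv/= => /andP[xz _]; apply: FdF; exact: lt_trans xz.
  apply: derivable_within_continuous => z; rewrite in_itv/= => /andP[xz _].
  by have [] := FdF z (lt_le_trans x0 xz).
rewrite in_itv/= => /andP[xc _] E; rewrite -subr_gt0 E mulr_gt0 ?subr_gt0//.
by apply: dF0; exact: lt_trans xc.
Qed.

Lemma ge0_derive_le (F dF : R -> R) :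
  (forall x : R, 0 < x -> is_derive x 1 F (dF x)) -> (forall x : R, 0 < x -> 0 <= dF x) ->
  forall x y : R, 0 < x -> x <= y -> F x <= F y.
Proof.
move=> FdF dF0 x y x0; rewrite le_eqVlt => /predU1P[->//|xy].
have [c] : exists2 c, c \in `]x, y[%R & F y - F x = dF c * (y - x).
  apply: MVT => //.
    move=> z; rewrite in_itv/= => /andP[xz _]; apply: FdF; exact: lt_trans xz.
  apply: derivable_within_continuous => z; rewrite in_itv/= => /andP[xz _].
  by have [] := FdF z (lt_le_trans x0 xz).
rewrite in_itv/= => /andP[xc _] E; rewrite -subr_ge0 E mulr_ge0 ?subr_ge0 ?(ltW xy)//.
by apply: dF0; exact: lt_trans xc.
Qed.

(** Weighted AM-GM for [1] and [x] with its equality case. With [x = expR l], dividing by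
    [x^(1 - lam)] leaves [1 <= lam e^(-(1 - lam) l) + (1 - lam) e^(lam l)]; in the bounds
    [expR y >= 1 + y] the linear parts cancel, and the second one is strict for [l != 0]. *)
Lemma powR_le_affine (lam x : R) : 0 < lam < 1 -> 0 < x ->
  x `^ (1 - lam) <= lam + (1 - lam) * x ?= iff (x == 1).
Proof.
move=> /andP[l0 l1] x0.
pose l := ln x; have xE : x = expR l by rewrite /l lnK.
have pE : x `^ (1 - lam) = expR ((1 - lam) * l) by rewrite /powR gt_eqF.
have e1 : lam = expR ((1 - lam) * l) * (lam * expR (- ((1 - lam) * l))).
  by rewrite mulrCA -expRD subrr expR0 mulr1.
have e2 : (1 - lam) * x = expR ((1 - lam) * l) * ((1 - lam) * expR (lam * l)).
  rewrite mulrCA -expRD xE; congr (_ * expR _); ring.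
have [x1|x1] := eqVneq x 1.
  by split; rewrite x1 powR1 ?mulr1 ?subrKC ?lexx ?eqxx.
have l_neq0 : l != 0.
  by apply: contra x1 => /eqP l_eq0; rewrite xE l_eq0 expR0.
suff lt : x `^ (1 - lam) < lam + (1 - lam) * x.
  by split; [exact: ltW|rewrite lt_eqF].
rewrite pE e2 [X in _ < X + _]e1 -mulrDr ltr_pMr ?expR_gt0//.
have h1 : 1 + lam * l < expR (lam * l).
  by apply: expR_gt1Dx; rewrite mulf_neq0// gt_eqF.
have h2 : 1 + - ((1 - lam) * l) <= expR (- ((1 - lam) * l)) by exact: expR_ge1Dx.
have h1' : 0 < (1 - lam) * (expR (lam * l) - (1 + lam * l)).
  by apply: mulr_gt0; rewrite subr_gt0.
have h2' : 0 <= lam * (expR (- ((1 - lam) * l)) - (1 + - ((1 - lam) * l))).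
  by apply: mulr_ge0; [exact: ltW|rewrite subr_ge0].
by nra.
Qed.

(** [A], [B], [H] stand for distribution functions on the positive half-line with densities [f],
    [g], [h]. Limits at both ends are phrased as values within [e] of [0] or [1], which is
    equivalent for monotone functions. *)
Variables (A B H f g h : R -> R) (lam : R).
Hypothesis lam01 : 0 < lam < 1.
Hypothesis dA : forall s : R, 0 < s -> is_derive s 1 A (f s).
Hypothesis dB : forall s : R, 0 < s -> is_derive s 1 B (g s).
Hypothesis dH : forall s : R, 0 < s -> is_derive s 1 H (h s).
Hypothesis f0 : forall s : R, 0 < s -> 0 < f s.
Hypothesis g0 : forall s : R, 0 < s -> 0 < g s.
Hypothesis A01 : forall s : R, 0 < s -> 0 <= A s <= 1.
Hypothesis B01 : forall s : R, 0 < s -> 0 <= B s <= 1.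
Hypothesis H01 : forall s : R, 0 < s -> 0 <= H s <= 1.
Hypothesis A_to0 : forall e : R, 0 < e -> exists2 s : R, 0 < s & A s < e.
Hypothesis A_to1 : forall e : R, 0 < e -> exists2 s : R, 0 < s & 1 - e < A s.
Hypothesis B_to0 : forall e : R, 0 < e -> exists2 s : R, 0 < s & B s < e.
Hypothesis B_to1 : forall e : R, 0 < e -> exists2 s : R, 0 < s & 1 - e < B s.
Hypothesis fgh : forall s t : R, 0 < s -> 0 < t ->
  f s `^ lam * g t `^ (1 - lam) <= h (lam * s + (1 - lam) * t).

Let A_lt := gt0_derive_lt _ _ dA f0.
Let B_lt := gt0_derive_lt _ _ dB g0.

Let B_inj (x y : R) : 0 < x -> 0 < y -> B x = B y -> x = y.
Proof.
move=> x0 y0 Bxy; have [xy|yx|//] := ltgtP x y.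
  by have := B_lt _ _ x0 xy; rewrite Bxy ltxx.
by have := B_lt _ _ y0 yx; rewrite Bxy ltxx.
Qed.

Let B_onto (y : R) : 0 < y < 1 -> exists2 x : R, 0 < x & B x = y.
Proof.
move=> /andP[y0 y1].
have [x1 x10 Bx1] := B_to0 _ y0.
have [x2 x20 Bx2] : exists2 x, 0 < x & y < B x.
  have /B_to1[x x0 xB] : 0 < 1 - y by rewrite subr_gt0.
  by exists x => //; rewrite subKr in xB.
have x12 : x1 <= x2.
  rewrite leNgt; apply/negP => /(B_lt _ _ x20) x21.
  by have := lt_trans (lt_trans Bx1 Bx2) x21; rewrite ltxx.
have [||c] := @IVT R B x1 x2 y x12.
- apply: derivable_within_continuous => z; rewrite in_itv/= => /andP[xz _].
  by have [] := dB z (lt_le_trans x10 xz).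
- have B12 : B x1 <= B x2 by exact/ltW/(lt_trans Bx1).
  by rewrite (min_idPl _)// (max_idPr _)// (ltW Bx1) (ltW Bx2).
rewrite in_itv/= => /andP[xc _] <-; exists c => //; exact: lt_le_trans xc.
Qed.

(** For positive [s] the default [0] is not met at [A s]: strict monotonicity puts [A s] in []0,
    1[], which [B_onto] places in the range of [B]. *)
Let Binv (y : R) : R := xget 0 [set x | 0 < x /\ B x = y].

Let BK (x : R) : 0 < x -> Binv (B x) = x.
Proof.
move=> x0; rewrite /Binv; case: xgetP => [y _ [y0 /B_inj]|/(_ x)]; first exact.
by move=> /(_ (conj x0 erefl)).
Qed.

(* The transport map from the law with cdf A to the law with cdf B. *)
Let T s := Binv (A s).

Let A_gt0lt1 (s : R) : 0 < s -> 0 < A s < 1.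
Proof.
move=> s0; apply/andP; split.
  have s20 : 0 < s / 2 by exact: divr_gt0.
  have /andP[+ _] := A01 _ s20; move/le_lt_trans; apply; apply: A_lt => //.
  by rewrite gtr_pMr// invf_lt1// ltr1n.
have s1 : 0 < s + 1 by exact: addr_gt0.
have /andP[_] := A01 _ s1; apply: lt_le_trans; apply: A_lt => //.
by rewrite ltrDl.
Qed.

Let T_spec (s : R) : 0 < s -> 0 < T s /\ B (T s) = A s.
Proof.
move=> /A_gt0lt1/B_onto[x x0 BxA]; by rewrite /T -BxA BK.
Qed.

Let T_derive (s : R) : 0 < s -> is_derive s 1 T (f s / g (T s)).
Proof.
move=> s0; have [Ts0 BTs] := T_spec _ s0.
have dBinv : is_derive (A s) 1 Binv (g (T s))^-1.
  rewrite -BTs; apply: is_derive_inverse.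
  - near=> x; apply: BK; near: x; exact: lt_nbhsr.
  - near=> x; have x0 : 0 < x by near: x; exact: lt_nbhsr.
    have [dBx _] := dB _ x0.
    exact/differentiable_continuous/derivable1_diffP.
  - exact: dB.
  - by rewrite gt_eqF// g0.
have := dA _ s0 => dAs.
have /= := @is_derive1_comp R Binv A s _ _ dBinv dAs.
by rewrite mulrC.
Unshelve. all: by end_near. Qed.

Let u s := lam * s + (1 - lam) * T s.

Let l0 : 0 < lam. Proof. by case/andP: lam01. Qed.
Let l1 : 0 < 1 - lam. Proof. by case/andP: lam01 => _; rewrite subr_gt0. Qed.

Let u_gt0 (s : R) : 0 < s -> 0 < u s.
Proof.
by move=> s0; have [Ts0 _] := T_spec _ s0; rewrite addr_gt0// mulr_gt0.
Qed.

(* D is nondecreasing by [fgh] and the weighted AM-GM inequality, and the limits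
   of A at both ends leave no room for it to be nonzero; so both inequalities
   are equalities everywhere. *)
Let D s := H (u s) - A s.
Let dD s := h (u s) * (lam + (1 - lam) * (f s / g (T s))) - f s.

Let D_derive (s : R) : 0 < s -> is_derive s 1 D (dD s).
Proof.
move=> s0; have := T_derive _ s0 => dT; have := dA _ s0 => dAs.
have du : is_derive s 1 u (lam + (1 - lam) * (f s / g (T s))).
  rewrite /u; apply: is_derive_eq; rewrite /GRing.scale /=; ring.
have dHu := dH _ (u_gt0 _ s0).
have := @is_derive1_comp R H u s _ _ dHu du => dc.
have := @is_deriveB _ _ _ _ _ s 1 _ _ dc dAs.
by rewrite /D /dD.
Qed.

(** The product of the first two factors is what [fgh] bounds by [h (u s)]; the last factor is what
    AM-GM bounds by the derivative of [u]. *)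
Let fE (s : R) : 0 < s ->
  f s = f s `^ lam * g (T s) `^ (1 - lam) * (f s / g (T s)) `^ (1 - lam).
Proof.
move=> s0; have [Ts0 _] := T_spec _ s0.
have := f0 _ s0 => fs0; have := g0 _ Ts0 => gs0.
rewrite -mulrA -powRM ?divr_ge0 ?ltW// mulrCA divff ?gt_eqF// mulr1.
by rewrite -powRD ?subrKC ?powRr1 ?ltW// oner_eq0.
Qed.

Let dD_ge0 (s : R) : 0 < s -> 0 <= dD s.
Proof.
move=> s0; have [Ts0 _] := T_spec _ s0.
have := f0 _ s0 => fs0; have := g0 _ Ts0 => gs0.
have [ag _] := powR_le_affine _ (f s / g (T s)) lam01 (divr_gt0 fs0 gs0).
rewrite /dD subr_ge0 [leLHS]fE//; apply: ler_pM => //; last exact: fgh.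
  by rewrite mulr_ge0 ?powR_ge0.
exact: powR_ge0.
Qed.

Let D_eq0 (s : R) : 0 < s -> D s = 0.
Proof.
move=> s0; have D_le := ge0_derive_le _ _ D_derive dD_ge0.
apply/eqP; rewrite eq_le; apply/andP; split; rewrite leNgt; apply/negP => Ds.
  (* A positive [D s] persists to the right and, once [A m > 1 - D s], pushes [H (u m)] above
     [1]. *)
  have [r r0 rA] := A_to1 _ Ds.
  pose m := Num.max r s.
  have m0 : 0 < m by rewrite lt_max s0 orbT.
  have Am : A r <= A m.
    rewrite /m; case: (leP r s) => // rs; exact: (ge0_derive_le _ _ dA (fun x x0 => ltW (f0 x x0))).
  have Dm : D s <= D m by apply: D_le => //; rewrite le_max lexx orbT.
  have /andP[_] := H01 _ (u_gt0 _ m0).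
  by move: Dm; rewrite /D in Ds rA *; lra.
(* A negative [D s] persists to the left and, once [A m < - D s], pushes [H (u m)] below [0]. *)
have /A_to0[r r0 rA] : 0 < - D s by rewrite oppr_gt0.
pose m := Num.min r s.
have m0 : 0 < m by rewrite lt_min s0 r0.
have Am : A m <= A r.
  rewrite /m; case: (leP r s) => // sr.
  exact: (ge0_derive_le _ _ dA (fun x x0 => ltW (f0 x x0)) _ _ s0 (ltW sr)).
have Dm : D m <= D s by apply: D_le => //; rewrite ge_min lexx orbT.
have /andP[+ _] := H01 _ (u_gt0 _ m0).
by move: Dm; rewrite /D in Ds rA *; lra.
Qed.

Let dD_eq0 (s : R) : 0 < s -> dD s = 0.
Proof.
move=> s0; have dDs := D_derive _ s0.
rewrite -(@derive_val _ _ _ _ _ _ _ dDs).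
rewrite (@near_eq_derive _ _ _ _ (cst 0)) ?derive_cst//.
near=> x; apply: D_eq0; near: x; exact: lt_nbhsr.
Unshelve. all: by end_near. Qed.

Let dT_eq1 (s : R) : 0 < s -> f s / g (T s) = 1.
Proof.
move=> s0; have [Ts0 _] := T_spec _ s0.
have := f0 _ s0 => fs0; have := g0 _ Ts0 => gs0.
have [ag agE] := powR_le_affine _ (f s / g (T s)) lam01 (divr_gt0 fs0 gs0).
apply/eqP; rewrite -agE; apply/eqP.
have P0 : 0 < f s `^ lam * g (T s) `^ (1 - lam) by rewrite mulr_gt0 ?powR_gt0.
(* With [P] the product [f^lam g^(1 - lam)], [f s] is [P] times the power side of AM-GM, and by
   [dD_eq0] it is [h (u s)] times the affine side. As [P <= h (u s)], both sides of AM-GM agree and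
   the ratio is [1]. *)
apply: (mulfI (lt0r_neq0 P0)); rewrite -fE//.
have := dD_eq0 _ s0; rewrite /dD => /eqP; rewrite subr_eq0 => /eqP fsE.
apply/eqP; rewrite eq_le; apply/andP; split; first by rewrite [leLHS]fE// ler_pM2l.
rewrite -[leRHS]fsE ler_pM2r; first exact: fgh.
by rewrite addr_gt0// mulr_gt0// divr_gt0.
Qed.

Let T_id (s : R) : 0 < s -> T s = s.
Proof.
move=> s0.
have dTs (x : R) : 0 < x -> is_derive x 1 (fun s => T s - s) 0.
  move=> x0; have := T_derive _ x0; rewrite dT_eq1// => dT.
  by apply: is_derive_eq; rewrite subrr.
have dTN (x : R) : 0 < x -> is_derive x 1 (fun s => - (T s - s)) 0.
  by move=> x0; have := dTs _ x0 => d; apply: is_derive_eq; rewrite oppr0.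
pose c := T s - s.
have Tc (x : R) : 0 < x -> T x = x + c.
  move=> x0.
  have le1 a b := @ge0_derive_le _ (fun=> 0) dTs (fun _ _ => lexx 0) a b.
  have le2 a b := @ge0_derive_le _ (fun=> 0) dTN (fun _ _ => lexx 0) a b.
  rewrite /c; have [xs|/ltW sx] := leP x s.
    by have := le1 _ _ x0 xs; have := le2 _ _ x0 xs; lra.
  by have := le1 _ _ s0 sx; have := le2 _ _ s0 sx; lra.
(* A negative shift would send [- c / 2] to [c / 2], which is not positive. *)
have c0 : 0 <= c.
  rewrite leNgt; apply/negP => c0.
  have c20 : 0 < - c / 2 by lra.
  by have [+ _] := T_spec _ c20; rewrite Tc//; lra.
suff : c <= 0 by move=> ?; rewrite Tc//; lra.
(* A positive shift keeps [T] above [c], hence [A], which is [B] after [T], above [B (c / 2) > 0];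
   this contradicts [A_to0]. *)
rewrite leNgt; apply/negP => {}c0.
have c20 : 0 < c / 2 by lra.
have Bc : 0 < B (c / 2).
  have c40 : 0 < c / 4 by lra.
  have /andP[+ _] := B01 _ c40; move=> /le_lt_trans; apply; apply: B_lt => //; lra.
have [r r0 rA] := A_to0 _ Bc.
have [_ BT] := T_spec _ r0.
have : B (c / 2) < B (T r) by apply: B_lt => //; rewrite Tc//; lra.
by rewrite BT => /(lt_trans rA); rewrite ltxx.
Qed.

(** The transport map is the identity, so [u s = s] and [f = g]; the vanishing of [dD] then gives
    [f = h], and the three densities coincide. *)
Lemma prekopa_leindler_cdf_eq (s : R) : 0 < s ->
  f s `^ lam * g s `^ (1 - lam) = h s.
Proof.
move=> s0.
have /eqP := dD_eq0 _ s0; rewrite /dD dT_eq1// subr_eq0 /u T_id//.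
have fs0 := f0 _ s0; have gs0 := g0 _ s0.
have fgs : f s = g s.
  have := dT_eq1 _ s0; rewrite T_id// => fg.
  by rewrite -[RHS]mul1r -fg divfK// gt_eqF.
rewrite mulr1 subrKC mulr1 -mulrDl subrKC mul1r => /eqP ->.
by rewrite -fgs -powRD ?subrKC ?powRr1 ?ltW// oner_eq0.
Qed.

End prekopa_leindler_equality.

(** * Distribution functions with density proportional to [expR (- s) * F s] *)

Section dilation_cdf.
Context {R : realType}.

Lemma expRM_integrable (c C r : R) : 0 < c ->
  (@lebesgue_measure R).-integrable `[r, +oo[
    (EFin \o (fun s => C * expR (- (c * s)))).
Proof.
move=> c0; pose e (s : R) := expR (- (c * s)).
have me : measurable_fun [set: R] e.
  apply: (measurableT_comp (@measurable_expR R)).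
  by apply: measurable_funN; exact: measurable_funM.
rewrite (_ : _ \o _ = (fun s => C%:E * (e s)%:E)%E)//.
apply: integrableZl => //; apply/integrableP; split.
  by apply/measurable_EFinP; exact: measurable_funTS.
under eq_integral do rewrite /= ger0_norm ?expR_ge0//.
by rewrite integral_expRM_itvcy// ltry.
Qed.

Lemma cst_integrable_itv (c a b : R) :
  (@lebesgue_measure R).-integrable `]a, b] (EFin \o (fun=> c)).
Proof.
apply/integrableP; split; first exact/measurable_EFinP.
rewrite integral_cst//= lebesgue_measure_itv/=.
by case: ifPn => _; rewrite ?mule0 ?ltry// -EFinD -EFinM ltry.
Qed.

Variables (F : R -> R) (a : R).
Hypothesis a_ge0 : 0 <= a.
Hypothesis F_gt0 : forall s : R, 0 < s -> 0 < F s.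
Hypothesis F_nd : forall s t : R, 0 < s -> s <= t -> F s <= F t.
Hypothesis F_dil : forall s t : R, 0 < s -> s <= t -> F t <= (t / s) `^ a * F s.
Let mu := @lebesgue_measure R.
Let f (s : R) := expR (- s) * F s.

(** Monotonicity and the dilation bound confine [F y] between [F x] and [(y / x)^a F x]. Continuity
    at every point is what makes the primitive [I] differentiable everywhere. *)
Let F_continuous (x : R) : 0 < x -> {for x, continuous F}.
Proof.
move=> x0; have Fx0 := F_gt0 _ x0.
have onea : 1 `^ a = 1 :> R by rewrite powR1.
pose e y := `|(y / x) `^ a - 1| * F x.
have e0 : e y @[y --> x] --> 0.
  rewrite -[X in _ --> X](mul0r (F x)); apply: cvgMl.
  rewrite -[X in _ --> X](@normr0 _ R); apply: cvg_norm.
  rewrite -[X in _ --> X](subrr 1); apply: cvgB; last exact: cvg_cst.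
  have {}oneE : 1 = (x / x) `^ a by rewrite divff ?gt_eqF// powR1.
  rewrite [X in _ --> X]oneE.
  have cx : {for x / x, continuous (fun y : R => y `^ a)}.
    apply/differentiable_continuous/derivable1_diffP/derivable_powR.
    by rewrite in_itv/= andbT divr_gt0.
  have cc : {for x, continuous (fun y : R => (y / x) `^ a)}.
    apply: (@continuous_comp R R R (fun y : R => y / x) (fun y : R => y `^ a)) => //.
    by apply: continuousM => //; exact: cst_continuous.
  exact: cc.
apply: (@squeeze_cvgr _ _ _ _ (fun y => F x - e y) (fun y => F x + e y)).
- near=> y; have y0 : 0 < y by near: y; exact: lt_nbhsr.
  have yx0 : 0 <= y / x by exact/ltW/divr_gt0.
  have xy0 : 0 <= x / y by exact/ltW/divr_gt0.
  rewrite -ler_distl /e.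
  have [xy|/ltW yx] := leP x y.
    have w1 : 1 <= (y / x) `^ a.
      rewrite -[leLHS]onea; apply: (ge0_ler_powR a_ge0); rewrite ?nnegrE//.
      by rewrite ler_pdivlMr// mul1r.
    have h1 := F_nd _ _ x0 xy; have h2 := F_dil _ _ x0 xy.
    by rewrite ger0_norm ?subr_ge0// ger0_norm ?subr_ge0//; lra.
  have w1 : (y / x) `^ a <= 1.
    rewrite -[leRHS]onea; apply: (ge0_ler_powR a_ge0); rewrite ?nnegrE//.
    by rewrite ler_pdivrMr// mul1r.
  have h1 := F_nd _ _ y0 yx; have h2 := F_dil _ _ y0 yx.
  have h3 : (y / x) `^ a * F x <= F y.
    rewrite (le_trans (ler_wpM2l (powR_ge0 _ _) h2))// mulrA -powRM//.
    by rewrite mulrA divfK ?gt_eqF// divff ?gt_eqF// powR1 mul1r.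
  by rewrite ler0_norm ?subr_le0// ler0_norm ?subr_le0//; lra.
- by rewrite -[X in _ --> X]subr0; apply: cvgB => //; exact: cvg_cst.
- by rewrite -[X in _ --> X]addr0; apply: cvgD => //; exact: cvg_cst.
Unshelve. all: by end_near. Qed.

Let f_continuous (x : R) : 0 < x -> {for x, continuous f}.
Proof.
move=> x0; apply: continuousM; last exact: F_continuous.
by apply: continuous_comp; [exact: opp_continuous|exact: continuous_expR].
Qed.

Let f_gt0 (x : R) : 0 < x -> 0 < f x.
Proof. by move=> x0; rewrite mulr_gt0 ?expR_gt0 ?F_gt0. Qed.

Let f_measurable (D : set R) : D `<=` `]0, +oo[ -> measurable_fun D f.
Proof.
move=> D0; apply: (@measurable_funS _ _ _ _ (`]0, +oo[%classic : set R)) => //.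
apply: open_continuous_measurable_fun => // x; rewrite inE/= in_itv/= andbT.
exact: f_continuous.
Qed.

Let f_bound : exists2 C, 0 < C & forall s : R, 0 < s -> f s <= C * expR (- (2^-1 * s)).
Proof.
(* With [b >= 2 a], the power [(b * expR (s / b))^a] grows at most like [expR (s / 2)]; the summand
   [2] keeps [b] positive when [a = 0]. *)
pose b := 2 * a + 2.
have b0 : 0 < b by rewrite /b; have := a_ge0; lra.
have F10 := F_gt0 _ (@ltr01 R).
exists ((1 + b `^ a) * F 1).
  by rewrite mulr_gt0// ltr_pwDl// powR_ge0.
move=> s s0.
have s_le : s `^ a <= b `^ a * expR (2^-1 * s).
  have sb : s <= b * expR (s / b).
    rewrite -ler_pdivrMl// mulrC; apply: le_trans (expR_ge1Dx _); lra.
  apply: (@le_trans _ _ ((b * expR (s / b)) `^ a)).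
    by rewrite ge0_ler_powR ?nnegrE ?mulr_ge0 ?expR_ge0// ltW.
  rewrite powRM ?expR_ge0 ?(ltW b0)// ler_wpM2l ?powR_ge0//.
  rewrite /powR gt_eqF ?expR_gt0// expRK ler_expR mulrCA mulrC ler_pM2r//.
  by rewrite ler_pdivrMr// /b; lra.
have -> : f s = F s * expR (- (2^-1 * s)) * expR (- (2^-1 * s)).
  by rewrite /f -mulrA -expRD mulrC; congr (_ * expR _); field.
rewrite ler_pM2r ?expR_gt0// -ler_pdivlMr ?expR_gt0// -expRN opprK.
have e1 : 1 <= expR (2^-1 * s) by rewrite -expR0 ler_expR mulr_ge0// ltW.
have bb := powR_ge0 b a.
(* The factor [1 + s^a] covers both ranges: monotonicity for [s <= 1], the dilation bound from [1]
   for [s >= 1]. *)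
apply: (@le_trans _ _ ((1 + s `^ a) * F 1)).
  have [s1|/ltW s1] := leP s 1.
    by rewrite (le_trans (F_nd _ _ s0 s1))// ler_peMl ?(ltW F10)// lerDl powR_ge0.
  have := F_dil _ _ ltr01 s1; rewrite divr1 => /le_trans; apply.
  by rewrite ler_wpM2r ?(ltW F10)// lerDr.
rewrite mulrAC ler_wpM2r ?(ltW F10)// mulrDl mul1r; lra.
Qed.

Let f_integrable : mu.-integrable `]0, +oo[ (EFin \o f).
Proof.
have [C C0 fC] := f_bound.
have gI : mu.-integrable `]0, +oo[ (EFin \o (fun s => C * expR (- (2^-1 * s)))).
  apply: integrableS (expRM_integrable 2^-1 C 0 _) => //.
  by move=> x /=; rewrite !in_itv/= !andbT => /ltW.
apply: le_integrable gI => //.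
- by apply/measurable_EFinP; exact: f_measurable.
- move=> x; rewrite /= in_itv/= andbT => x0.
  rewrite lee_fin !ger0_norm ?fC ?(ltW (f_gt0 _ x0))//.
  by rewrite mulr_ge0 ?expR_ge0 ?ltW.
Qed.

Let I (s : R) := (\int[mu]_(x in `]0%R, s]) f x)%R.
Let alpha := (\int[mu]_(x in `]0%R, +oo[) f x)%R.

Let integrable_itv (i : interval R) : [set` i] `<=` `]0, +oo[ ->
  mu.-integrable [set` i] (EFin \o f).
Proof. by move=> i0; apply: integrableS f_integrable => //; exact: measurable_itv. Qed.

Let alpha_gt0 : 0 < alpha.
Proof.
apply: (@lt_le_trans _ _ (\int[mu]_(x in `]1, 2]) f x)%R).
  apply: (@lt_le_trans _ _ (\int[mu]_(x in `]1%R, 2%R]) (expR (- 2) * F 1))%R).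
    rewrite /Rintegral integral_cst//= lebesgue_measure_itv/= lte_fin ltr1n.
    by rewrite -EFinD -EFinM /= addrK mulr1 mulr_gt0 ?expR_gt0 ?F_gt0.
  apply: le_Rintegral => //.
  - by apply: cst_integrable_itv.
  - apply: integrable_itv => x /=; rewrite !in_itv/= andbT => /andP[+ _]; lra.
  - move=> x /=; rewrite in_itv/= => /andP[x1 x2].
    apply: ler_pM; rewrite ?expR_ge0 ?(ltW (F_gt0 _ ltr01))//.
      by rewrite ler_expR; lra.
    by apply: F_nd => //; exact: ltW.
have s12 : `]1, 2] `<=` (`]0, +oo[ : set R).
  by move=> x /=; rewrite !in_itv/= andbT => /andP[+ _]; lra.
rewrite /alpha /Rintegral fine_le//; try by apply: integrable_fin_num => //; exact: integrable_itv.
apply: ge0_subset_integral => //.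
  by apply/measurable_EFinP; exact: f_measurable.
by move=> x /=; rewrite in_itv/= andbT lee_fin => x0; exact/ltW/f_gt0.
Qed.

Let I_derive (s : R) : 0 < s -> is_derive s 1 I (f s).
Proof.
move=> s0.
have [] := @continuous_FTC1 R f (BRight 0) s (s + 1) _ _ _ (f_continuous _ s0).
- by rewrite ltrDl.
- by apply: integrable_itv => x /=; rewrite !in_itv/= andbT => /andP[].
- exact: s0.
by move=> dI <-; rewrite derive1E; exact: DeriveDef.
Qed.

Let alphaB (s : R) : 0 < s -> alpha - I s = (\int[mu]_(x in `]s, +oo[) f x)%R.
Proof.
move=> s0; rewrite /alpha /I Rintegral_itvB// leBSide/=.
exact: ltW.
Qed.

Let I_ge0 (s : R) : 0 < s -> 0 <= I s.
Proof.
move=> s0; apply: Rintegral_ge0 => // x; rewrite /= in_itv/= => /andP[x0 _].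
exact/ltW/f_gt0.
Qed.

Let I_le (s : R) : 0 < s -> s <= 1 -> I s <= s * F 1.
Proof.
move=> s0 s1.
apply: (@le_trans _ _ (\int[mu]_(x in `]0%R, s]) F 1)%R).
  apply: le_Rintegral => //.
  - by apply: integrable_itv => x /=; rewrite !in_itv/= andbT => /andP[].
  - exact: cst_integrable_itv.
  move=> x /=; rewrite in_itv/= => /andP[x0 xs]; rewrite -[leRHS]mul1r.
  apply: ler_pM; rewrite ?expR_ge0 ?(ltW (F_gt0 _ x0))//.
    by rewrite -expR0 ler_expR; lra.
  by apply: F_nd => //; lra.
rewrite /Rintegral integral_cst//= lebesgue_measure_itv/= lte_fin s0.
by rewrite -EFinD -EFinM /= subr0 mulrC.
Qed.

Lemma dilation_cdf : exists (al : R) (A : R -> R), [/\ 0 < al,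
  (\int[lebesgue_measure]_(s in `]0%R, +oo[) (expR (- s) * F s)%:E = al%:E)%E,
  forall s : R, 0 < s -> is_derive s 1 A (expR (- s) * F s / al) &
  [/\ forall s : R, 0 < s -> 0 <= A s <= 1,
   forall e : R, 0 < e -> exists2 s : R, 0 < s & A s < e &
   forall e : R, 0 < e -> exists2 s : R, 0 < s & 1 - e < A s]].
Proof.
have al0 := alpha_gt0.
exists alpha, (fun s => I s / alpha); split => //.
- by rewrite /alpha /Rintegral fineK//; exact: integrable_fin_num.
- move=> s s0; have := I_derive _ s0 => dI.
  by apply: is_derive_eq; rewrite /GRing.scale /= /f; field; exact: lt0r_neq0.
split.
- move=> s s0; apply/andP; split; first exact: divr_ge0 (I_ge0 _ s0) (ltW al0).
  rewrite ler_pdivrMr// mul1r.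
  rewrite -subr_ge0 alphaB//; apply: Rintegral_ge0 => // x; rewrite /= in_itv/= andbT => sx.
  by apply/ltW/f_gt0; lra.
- move=> e e0; have F10 := F_gt0 _ (@ltr01 R).
  (* Chosen so that [I s <= s * F 1] is at most half of [e * alpha]. *)
  pose s := Num.min 1 (e * alpha / (2 * F 1)).
  have s0 : 0 < s by rewrite lt_min ltr01 divr_gt0 ?mulr_gt0.
  exists s => //; rewrite ltr_pdivrMr//.
  have s1 : s <= 1 by rewrite ge_min lexx.
  apply: (le_lt_trans (I_le _ s0 s1)).
  have : s <= e * alpha / (2 * F 1) by rewrite ge_min lexx orbT.
  rewrite ler_pdivlMr ?mulr_gt0// => h.
  have ea : 0 < e * alpha by rewrite mulr_gt0.
  have E : s * (2 * F 1) = 2 * (s * F 1) by ring.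
  by rewrite E in h; lra.
- move=> e e0; have [C C0 fC] := f_bound.
  (* The tail beyond [2 K] is at most [2 C expR (- K) = alpha e K expR (- K)], which is below
     [alpha e] since [K < 1 + K <= expR K]. *)
  pose K := 2 * C / (alpha * e).
  have K0 : 0 < K by rewrite divr_gt0 ?mulr_gt0.
  have s0 : 0 < 2 * K by rewrite mulr_gt0.
  exists (2 * K) => //.
  have : (\int[mu]_(x in `]2 * K, +oo[) f x)%R <= 2 * C * expR (- K).
    apply: (@le_trans _ _ (\int[mu]_(x in `]2 * K, +oo[) (C * expR (- (2^-1 * x))))%R).
      apply: le_Rintegral => //.
      - by apply: integrable_itv => x /=; rewrite !in_itv/= !andbT; lra.
      - apply: integrableS (expRM_integrable 2^-1 C (2 * K) _) => //.
        by move=> x /=; rewrite !in_itv/= !andbT => /ltW.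
      - by move=> x /=; rewrite in_itv/= andbT => sx; apply: fC; lra.
    rewrite Rintegral_itv_obnd_cbnd; last first.
      apply: integrableS (expRM_integrable 2^-1 C (2 * K) _) => //.
      by move=> x /=; rewrite !in_itv/= !andbT => /ltW.
    rewrite RintegralZl//; last first.
      have := expRM_integrable 2^-1 1 (2 * K) _.
      by under [X in EFin \o X]eq_fun do rewrite mul1r; apply.
    rewrite /Rintegral integral_expRM_itvcy//= mulKf// invrK.
    by rewrite (_ : C * (expR (- K) * 2) = 2 * C * expR (- K))//; ring.
  rewrite -alphaB// => h.
  have eK : 2 * C * expR (- K) < alpha * e.
    have KE : 2 * C = K * (alpha * e) by rewrite /K divfK// gt_eqF// mulr_gt0.
    rewrite KE mulrAC gtr_pMl ?mulr_gt0// expRN ltr_pdivrMr ?expR_gt0// mul1r.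
    by apply: lt_le_trans (expR_ge1Dx _); rewrite ltrDr.
  by rewrite ltr_pdivlMr//; lra.
Qed.

End dilation_cdf.

(** * Homogeneous strictly convex functions and their gradients *)

Section homogeneous_convex.
Context {R : realType} {n : nat}.
Implicit Types (V : 'rV[R]_n -> R) (x y : 'rV[R]_n).

(** Restriction to a line makes the one-variable chain rule available where only directional
    derivatives of [V] are at hand. *)
Lemma is_derive_lineP V y v (d : R) :
  is_derive y v V d <-> is_derive (0 : R) 1 (fun k : R => V (k *: v + y)) d.
Proof.
have E : (fun h : R => h^-1 *: ((V \o shift y) (h *: v) - V y)) =
    (fun h : R => h^-1 *: (((fun k : R => V (k *: v + y)) \o shift (0 : R)) (h *: (1 : R))
      - (fun k : R => V (k *: v + y)) 0)).
  by apply/funext => h /=; rewrite scale0r add0r addr0 [h%:A]mulr1.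
split=> -[dV <-].
  by split; [rewrite /derivable -E|rewrite /derive -E].
by split; [rewrite /derivable E|rewrite /derive E].
Qed.

Lemma is_derive_scale_line (f : R -> R) (c d : R) : is_derive (0 : R) 1 f d ->
  is_derive (0 : R) 1 (fun k => f (c * k)) (c * d).
Proof.
move=> df.
have df' : is_derive (c * 0) 1 f d by rewrite mulr0.
have dc : is_derive (0 : R) 1 (fun k : R => c * k) c.
  by apply: is_derive_eq; rewrite /GRing.scale /=; ring.
by have := @is_derive1_comp R f (fun k : R => c * k) 0 _ _ df' dc; rewrite mulrC.
Qed.

Lemma is_derive_right_ge0 (f : R -> R) (d : R) : is_derive (0 : R) 1 f d ->
  (forall h : R, 0 < h -> f 0 <= f h) -> 0 <= d.
Proof.
move=> [df <-] f0.
rewrite /derive cvg_at_rightE//; apply: limr_ge.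
  by move/cvg_ex: df => [l dl]; apply/cvg_ex; exists l; exact: cvg_dnbhs_at_right.
near=> h; have h0 : 0 < h by near: h; exact: nbhs_right_gt.
rewrite /= addr0 [h%:A]mulr1 mulr_ge0 ?invr_ge0 ?(ltW h0)// subr_ge0.
exact: f0.
Unshelve. all: by end_near. Qed.

Lemma measurable_continuous_off0 (f : 'rV[R]_n -> R) :
  (forall x, x != 0 -> {for x, continuous f}) ->
  measurable_fun [set: 'rV[R]_n] f.
Proof.
move=> cf; apply: (measurability _ (RGenOInfty.measurableE R)).
move=> _ [_ [a ->] <-]; rewrite setTI; set A := _ @^-1` _.
rewrite -(setIT A) -(setvU [set 0]) setIUr; apply: measurableU.
  apply: open_measurable_rV; rewrite openE => x [Ax /eqP x0].
  rewrite /interior; near=> y; split; last first.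
    have xy : `|x - y| < `|x|.
      near: y; apply: (@cvgr_dist_lt _ _ _ (nbhs x) _ id x); first exact: cvg_id.
      by rewrite normr_gt0.
    by move=> /= y0; rewrite y0 subr0 ltxx in xy.
  rewrite /A /= in_itv/= andbT; near: y; apply: cvgr_gt; first exact: cf.
  by move: Ax; rewrite /A /= in_itv/= andbT.
have m0 : measurable [set 0 : 'rV[R]_n].
  have := @measurable_box_rV R n (fun=> [set 0]) (fun=> measurable_set1 _).
  rewrite (_ : mkset _ = [set 0])//; apply/seteqP; split=> x /=.
    by move=> x0; apply/rowP => i; rewrite x0 mxE.
  by move=> -> i; rewrite mxE.
have [A0|A0] := pselect (A 0).
  by rewrite setIidr// => x ->.
by rewrite (_ : _ `&` _ = set0)//; apply/seteqP; split=> x // [] /[swap] ->.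
Unshelve. all: by end_near. Qed.

Variables (p : R) (V : 'rV[R]_n -> R).
Hypothesis p_gt1 : 1 < p.
Hypothesis V_even : even_fun V.
Hypothesis V_sc : strictly_convex V.
Hypothesis V_hom : p_homogeneous p (fun x => (V x)%:E).

Let p0 : 0 < p. Proof. by apply: lt_trans p_gt1. Qed.

Lemma homogeneousE (t : R) x : 0 <= t -> V (t *: x) = t `^ p * V x.
Proof. by move=> t0; have := V_hom t x t0; rewrite -EFinM => -[]. Qed.

Lemma homogeneous0 : V 0 = 0.
Proof. by rewrite -(scale0r 0) homogeneousE// powR0 ?mul0r// gt_eqF. Qed.

(** Strict convexity at the midpoint [0] of [x] and [- x]. *)
Lemma homogeneous_gt0 x : x != 0 -> 0 < V x.
Proof.
move=> x0.
have xNx : x != - x.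
  apply: contra x0 => /eqP xNx; have : x + x = 0 by rewrite {2}xNx subrr.
  by rewrite -mulr2n -scaler_nat => /eqP; rewrite scaler_eq0 pnatr_eq0.
have h : 0 < 2^-1 :> R by [].
have h1 : 2^-1 < 1 :> R by rewrite invf_lt1// ltr1n.
have := V_sc x (- x) 2^-1 xNx h h1.
rewrite V_even scalerN -scalerBl (_ : 2^-1 - (1 - 2^-1) = 0 :> R); last by field.
by rewrite scale0r homogeneous0 -mulrDl subrKC mul1r.
Qed.

Lemma homogeneous_ge0 x : 0 <= V x.
Proof.
by have [->|/homogeneous_gt0/ltW//] := eqVneq x 0; rewrite homogeneous0.
Qed.

Lemma homogeneous_mean_le (m : nat) (z : 'I_m -> 'rV[R]_n) : (0 < m)%N ->
  V (m%:R^-1 *: \sum_i z i) <= m%:R^-1 * \sum_i V (z i).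
Proof.
case: m z => // m z _; elim: m z => [|m IH] z.
  by rewrite !big_ord1 invr1 scale1r mul1r.
pose t : R := m.+2%:R^-1.
have t01 : 0 < t < 1.
  by rewrite /t invr_gt0 ltr0n/= invf_lt1 ?ltr0n// ltr1n.
have /andP[t0 t1] := t01.
have E : 1 - t = m.+1%:R / m.+2%:R.
  have m2 : m.+2%:R != 0 :> R by rewrite pnatr_eq0.
  by apply: (mulIf m2); rewrite divfK// mulrBl mulVf// mul1r -(natr1 m.+1) addrK.
pose u := m.+1%:R^-1 *: \sum_(i < m.+1) z (lift ord0 i).
rewrite -/t.
have -> : t *: \sum_i z i = t *: z ord0 + (1 - t) *: u.
  rewrite big_ord_recl scalerDr; congr (_ + _).
  by rewrite /u scalerA E mulrAC divff ?pnatr_eq0// mul1r.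
have cvx : V (t *: z ord0 + (1 - t) *: u) <= t * V (z ord0) + (1 - t) * V u.
  have [->|zu] := eqVneq (z ord0) u; last exact/ltW/V_sc.
  by rewrite -scalerDl -mulrDl subrKC scale1r mul1r.
apply: (le_trans cvx).
rewrite big_ord_recl mulrDr lerD2l.
apply: (@le_trans _ _ ((1 - t) * (m.+1%:R^-1 * \sum_(i < m.+1) V (z (lift ord0 i))))).
  by rewrite ler_wpM2l ?IH// subr_ge0 ltW.
have tE : (1 - t) * m.+1%:R^-1 = t.
  by rewrite E mulrAC divff ?pnatr_eq0// mul1r.
by rewrite mulrA tE.
Qed.

Hypothesis V_C1 : Ck_on 1 (~` [set 0]) V.

Let dV y (i : 'I_n) : y != 0 -> is_derive y (delta_mx 0 i) V (grad V y 0 i).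
Proof.
move=> /eqP y0; rewrite /grad mxE; apply: DeriveDef => //.
by have [_ /(_ i)[+ _]] := V_C1; apply.
Qed.

(* The C^1 hypothesis excludes the origin; there p > 1 gives the derivative. *)
Let dV0 (i : 'I_n) : is_derive 0 (delta_mx 0 i) V 0.
Proof.
apply/is_derive_lineP; pose c := V (delta_mx 0 i).
have VE (k : R) : V (k *: delta_mx 0 i + 0) = `|k| `^ p * c.
  rewrite addr0 -homogeneousE//; have [k0|k0] := leP 0 k.
    by rewrite ger0_norm.
  by rewrite ltr0_norm// scaleNr V_even.
rewrite (_ : (fun k : R => _) = (fun k : R => `|k| `^ p * c)); last exact/funext.
have L : h^-1 *: (((fun k : R => `|k| `^ p * c) \o shift (0 : R)) (h *: (1 : R)) -
    `|0 : R| `^ p * c) @[h --> (0 : R)^'] --> (0 : R).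
  apply/cvgrPdist_le => e e0.
  (* The difference quotient has size [|h|^(p - 1) |c|], and [d^(p - 1) = e / (|c| + 1)]; the [+ 1]
     spares a case on [c]. *)
  pose d := (e / (`|c| + 1)) `^ (p - 1)^-1.
  have c1 : 0 < `|c| + 1 by rewrite ltr_pwDr.
  have p1 : 0 < p - 1 by rewrite subr_gt0.
  have d0 : 0 < d by rewrite powR_gt0// divr_gt0.
  near=> h; have h0 : h != 0 by near: h; exact: nbhs_dnbhs_neq.
  rewrite sub0r normrN /= addr0 [h%:A]mulr1 normr0 powR0 ?gt_eqF// mul0r subr0.
  rewrite /GRing.scale /= !normrM normfV (ger0_norm (powR_ge0 _ _)).
  rewrite -(@mulr_powRB1 _ `|h| p)// -mulrA mulKf ?normr_eq0//.
  have hd : `|h| <= d.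
    by near: h; exact: dnbhs0_le.
  apply: (@le_trans _ _ (d `^ (p - 1) * (`|c| + 1))).
    apply: ler_pM => //; rewrite ?powR_ge0 ?lerDl//.
    by apply: ge0_ler_powR; rewrite ?nnegrE// ltW.
  rewrite /d -powRrM mulVf ?gt_eqF// powRr1 ?divr_ge0 ?(ltW e0) ?(ltW c1)//.
  by rewrite divfK// gt_eqF.
split; first by apply/cvg_ex; exists 0; exact: L.
exact/cvg_lim.
Unshelve. all: by end_near. Qed.

Lemma grad_homogeneous0 : grad V 0 = 0.
Proof.
by apply/rowP => i; rewrite !mxE; have := dV0 i => d; rewrite derive_val.
Qed.

(** Differentiating [V (k e_i + t y) = t^p V ((k / t) e_i + y)] at [k = 0] costs one power of
    [t]. *)
Lemma grad_homogeneousE (t : R) y : 0 < t ->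
  grad V (t *: y) = t `^ (p - 1) *: grad V y.
Proof.
move=> t0; have [->|y0] := eqVneq y 0.
  by rewrite scaler0 grad_homogeneous0 scaler0.
apply/rowP => i; rewrite [RHS]mxE {1}/grad mxE.
have /is_derive_lineP/(is_derive_scale_line _ t^-1) d := dV _ i y0.
suff : is_derive (t *: y) (delta_mx 0 i) V (t `^ (p - 1) * grad V y 0 i).
  by move=> d'; rewrite derive_val.
apply/is_derive_lineP.
rewrite (_ : (fun k : R => _) =
    (fun k : R => t `^ p * V ((t^-1 * k) *: delta_mx 0 i + y))); last first.
  apply/funext => k; rewrite -homogeneousE ?ltW// scalerDr scalerA mulrA.
  by rewrite divff ?gt_eqF// mul1r.
apply: is_derive_eq; rewrite /GRing.scale /= -(@mulr_powRB1 _ t p) ?(ltW t0)//.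
by field; exact: lt0r_neq0.
Qed.

(* V is only known to have partial derivatives, so y is moved in the direction y
   by averaging n moves along the axes and using convexity. *)
Lemma homogeneous_le_dot_grad y : y != 0 -> V y <= dotprod y (grad V y).
Proof.
move=> y0.
have n0 : (0 < n)%N.
  rewrite lt0n; apply: contra y0 => /eqP n0; apply/eqP/rowP => i.
  by have := ltn_ord i; rewrite [X in (_ < X)%N]n0.
have nN0 : n%:R != 0 :> R by rewrite pnatr_eq0 -lt0n.
pose z (i : 'I_n) (h : R) := (n%:R * y 0 i * h) *: delta_mx 0 i + y.
(* [psi] vanishes at [0], has the desired difference as derivative there, and is nonnegative for
   [h > 0]: the points [z i h] have mean [(1 + h) y], so Jensen bounds the mean of [V] below by
   [(1 + h)^p V y >= (1 + h) V y]. *)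
pose psi (h : R) := n%:R^-1 * (\sum_i V (z i h)) - V y - h * V y.
have dpsi : is_derive (0 : R) 1 psi (dotprod y (grad V y) - V y).
  have dz (i : 'I_n) : is_derive (0 : R) 1 (fun h => V (z i h))
      (n%:R * y 0 i * grad V y 0 i).
    by have /is_derive_lineP/(is_derive_scale_line _ (n%:R * y 0 i)) := dV _ i y0.
  have ds := @is_derive_sum _ _ _ n (fun i h => V (z i h)) 0 1 _ dz.
  rewrite (_ : psi = (fun h => n%:R^-1 * ((\sum_i (fun h => V (z i h))) h) - V y - h * V y)).
    apply: is_derive_eq; rewrite /GRing.scale /= /dotprod.
    have -> : \sum_i y 0 i * grad V y 0 i =
        n%:R^-1 * \sum_i (n%:R * y 0 i * grad V y 0 i).
      by rewrite mulr_sumr; apply: eq_bigr => i _; rewrite !mulrA mulVf// mul1r.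
    by ring.
  by apply/funext => h; rewrite /psi fct_sumE.
have psi0 : psi 0 = 0.
  rewrite /psi (eq_bigr (fun=> V y)) => [|i _]; last by rewrite /z mulr0 scale0r add0r.
  by rewrite sumr_const card_ord mul0r subr0 -(mulr_natl (V y)) mulKf// subrr.
rewrite -subr_ge0; apply: (is_derive_right_ge0 _ _ dpsi) => h h0; rewrite psi0.
have sumz : n%:R^-1 *: \sum_i z i h = (1 + h) *: y.
  rewrite big_split/= sumr_const card_ord scalerDr -(scaler_nat n y) scalerA mulVf// scale1r.
  rewrite addrC scalerDl scale1r; congr (_ + _).
  rewrite [in RHS](row_sum_delta y) !scaler_sumr; apply: eq_bigr => i _.
  by rewrite !scalerA; congr (_ *: _); field.
have := homogeneous_mean_le _ (z^~ h) n0.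
have h1_ge0 : 0 <= 1 + h by rewrite addr_ge0// ltW.
rewrite sumz homogeneousE// => mle.
have Vy := homogeneous_ge0 y.
have h1 : 1 + h <= (1 + h) `^ p by apply: le1r_powR; [rewrite lerDl ltW|exact: ltW].
have : (1 + h) * V y <= (1 + h) `^ p * V y by rewrite ler_wpM2r.
by rewrite /psi; lra.
Qed.

(** [c] is the minimum of [V] on the unit sphere of the sup norm, which is empty in dimension
    [0]. *)
Lemma homogeneous_coercive : exists2 c : R, 0 < c &
  forall y, c * `|y| `^ p <= V y.
Proof.
pose S : set 'rV[R]_n := [set x | `|x| = 1].
have [S0|/set0P S0] := eqVneq S set0.
  exists 1 => // y; have [->|y0] := eqVneq y 0.
    by rewrite normr0 powR0 ?gt_eqF// mulr0 homogeneous0.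
  have : S (`|y|^-1 *: y) by rewrite /S /= normrZ normfV normr_id mulVf ?normr_eq0.
  by rewrite S0.
have cS : compact S.
  apply: bounded_closed_compact.
    by exists 1; split=> // M M1 x /= ->; exact: ltW.
  apply: (@closed_comp _ _ (fun x : 'rV[R]_n => `|x|) [set 1]).
    by move=> x _; exact: norm_continuous.
  by apply: compact_closed; [exact: norm_hausdorff|exact: compact_set1].
have S_neq0 x : S x -> x != 0.
  by move=> Sx; rewrite -normr_eq0 Sx oner_eq0.
have cV : {within S, continuous V}.
  apply: continuous_in_subspaceT => x; rewrite inE => /S_neq0/eqP x0.
  by have [+ _] := V_C1; apply.
have [c0 c0S minc] := EVT_min_rV S0 cS cV.
rewrite inE in c0S.
exists (V c0); first exact/homogeneous_gt0/S_neq0.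
move=> y; have [->|y0] := eqVneq y 0.
  by rewrite normr0 powR0 ?gt_eqF// mulr0 homogeneous0.
have Sy : S (`|y|^-1 *: y) by rewrite /S /= normrZ normfV normr_id mulVf ?normr_eq0.
have ny : 0 < `|y| by rewrite normr_gt0.
have := minc (`|y|^-1 *: y); rewrite inE => /(_ Sy) mincy.
rewrite -[in leRHS](scale1r y) -(@divff _ `|y|) ?gt_eqF// -scalerA homogeneousE//.
by rewrite mulrC ler_wpM2l ?powR_ge0.
Qed.

(** The chain [c |y|^p <= V y <= <y, grad V y> <= n |C| |y|] bounds [|y|^(p - 1)]. This gives the
    sublevel sets of the dual function finite volume. *)
Lemma grad_homogeneous_bounded (C : R) : exists M : R, forall y,
  (forall i, `|grad V y 0 i| <= C) -> forall i, `|y 0 i| <= M.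
Proof.
have [c c0 cV] := homogeneous_coercive.
exists ((n%:R * `|C| / c) `^ (p - 1)^-1) => y yC i.
have yi : `|y 0 i| <= `|y|.
  by rewrite [leRHS]mx_normrE (le_trans _ (le_bigmax _ _ (0, i))).
apply: (le_trans yi).
have [->|y0] := eqVneq y 0; first by rewrite normr0 powR_ge0.
have ny : 0 < `|y| by rewrite normr_gt0.
have H : c * `|y| `^ p <= n%:R * `|C| * `|y|.
  apply: (le_trans (cV y)); apply: (le_trans (homogeneous_le_dot_grad _ y0)).
  apply: (@le_trans _ _ (\sum_(i < n) (`|y| * `|C|))).
    apply: ler_sum => j _; apply: (le_trans (ler_norm _)); rewrite normrM.
    apply: ler_pM => //; last by apply: le_trans (ler_norm _).
    by rewrite [leRHS]mx_normrE (le_trans _ (le_bigmax _ _ (0, j))).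
  by rewrite sumr_const card_ord -mulr_natl; lra.
have H' : `|y| `^ (p - 1) <= n%:R * `|C| / c.
  rewrite ler_pdivlMr// -(ler_pM2r ny); apply: le_trans H.
  rewrite -(@mulr_powRB1 _ `|y| p)//; nra.
have E : `|y| = (`|y| `^ (p - 1)) `^ (p - 1)^-1.
  by rewrite -powRrM divff ?powRr1// subr_eq0 gt_eqF.
rewrite [leLHS]E.
apply: ge0_ler_powR; rewrite ?nnegrE ?powR_ge0//.
  by rewrite invr_ge0 subr_ge0 ltW.
by apply: divr_ge0; [exact: mulr_ge0|exact: ltW].
Qed.

Lemma measurable_grad : measurable_fun [set: 'rV[R]_n] (grad V).
Proof.
apply: measurable_fun_rV => i; under eq_fun do rewrite mxE.
apply: measurable_continuous_off0 => x /eqP x0.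
by have [_ /(_ i)[_ [+ _]]] := V_C1; apply.
Qed.

End homogeneous_convex.

(** * Euclidean inner product and norm *)

Section dotprod_theory.
Context {R : realType} {n : nat}.
Implicit Types x y w : 'rV[R]_n.

Lemma dotprodC x y : dotprod x y = dotprod y x.
Proof. by apply: eq_bigr => i _; rewrite mulrC. Qed.

Lemma dotprodDl x y w : dotprod (x + y) w = dotprod x w + dotprod y w.
Proof. by rewrite /dotprod -big_split; apply: eq_bigr => i _; rewrite mxE mulrDl. Qed.

Lemma dotprodZl (c : R) x w : dotprod (c *: x) w = c * dotprod x w.
Proof. by rewrite /dotprod mulr_sumr; apply: eq_bigr => i _; rewrite mxE mulrA. Qed.

Lemma dotprodZr (c : R) x w : dotprod x (c *: w) = c * dotprod x w.
Proof. by rewrite dotprodC dotprodZl dotprodC. Qed.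

Lemma dotprodNl x w : dotprod (- x) w = - dotprod x w.
Proof. by rewrite -scaleN1r dotprodZl mulN1r. Qed.

Lemma dotprodNr x w : dotprod x (- w) = - dotprod x w.
Proof. by rewrite dotprodC dotprodNl dotprodC. Qed.

Lemma dotprod0l w : dotprod 0 w = 0.
Proof. by rewrite -(scale0r 0) dotprodZl mul0r. Qed.

Lemma dotprod_delta (i : 'I_n) w : dotprod (delta_mx 0 i) w = w 0 i.
Proof.
rewrite /dotprod (bigD1 i)//= big1 ?addr0 => [|j ji].
  by rewrite mxE !eqxx mul1r.
by rewrite mxE (negbTE ji) andbF mul0r.
Qed.

Lemma coord_le_enorm x (i : 'I_n) : `|x 0 i| <= enorm x.
Proof.
rewrite -sqrtr_sqr /enorm ler_wsqrtr// /dotprod (bigD1 i)//= expr2 lerDl.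
by apply: sumr_ge0 => j _; rewrite -expr2 sqr_ge0.
Qed.

Lemma enorm_le_sum x : enorm x <= \sum_i `|x 0 i|.
Proof.
have s0 : 0 <= \sum_i `|x 0 i| by exact: sumr_ge0.
rewrite -[leRHS]ger0_norm// -sqrtr_sqr /enorm ler_wsqrtr// expr2 mulr_suml.
apply: ler_sum => i _; apply: (le_trans (ler_norm _)); rewrite normrM.
apply: ler_wpM2l => //; rewrite [leRHS](bigD1 i)//= lerDl.
exact: sumr_ge0.
Qed.

Lemma enormZ (c : R) x : enorm (c *: x) = `|c| * enorm x.
Proof.
by rewrite /enorm dotprodZl dotprodZr mulrA -expr2 sqrtrM ?sqr_ge0// sqrtr_sqr.
Qed.

Lemma dotprod_le_enorm x w (d : R) : \sum_i `|w 0 i| <= d ->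
  dotprod x w <= enorm x * d.
Proof.
move=> wd; apply: (@le_trans _ _ (enorm x * \sum_i `|w 0 i|)); last first.
  by rewrite ler_wpM2l// sqrtr_ge0.
rewrite mulr_sumr; apply: ler_sum => i _; apply: (le_trans (ler_norm _)).
by rewrite normrM ler_wpM2r// coord_le_enorm.
Qed.

Lemma continuous_dotprod x : continuous (dotprod x).
Proof.
rewrite (_ : dotprod x = \sum_i (fun w => x 0 i * w 0 i)); last first.
  by apply/funext => w; rewrite fct_sumE.
elim/big_rec: _ => [|i f _ cf]; first exact: cst_continuous.
move=> w; apply: continuousD; last exact: cf.
by apply: continuousM; [exact: cst_continuous|exact: coord_continuous].
Qed.

End dotprod_theory.

(** * Legendre transform *)

Section legendre_theory.
Context {R : realType} {n : nat}.
Local Open Scope ereal_scope.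
Variable Phi : 'rV[R]_n -> \bar R.
Implicit Types x w : 'rV[R]_n.

Lemma legendre_ge x w : (dotprod x w)%:E - Phi x <= legendre Phi w.
Proof. by apply: ereal_sup_ubound; exists x. Qed.

Lemma legendre_le w (a : \bar R) :
  (forall x, (dotprod x w)%:E - Phi x <= a) -> legendre Phi w <= a.
Proof. by move=> h; apply: ub_ereal_sup => _ [x _ <-]. Qed.

Hypothesis Phi_gtNy : forall x, -oo < Phi x.

Lemma legendre_lsc : lower_semicontinuous (legendre Phi).
Proof.
move=> w a /ereal_sup_gt[_ [x _ <-]].
have := Phi_gtNy x; case Phix : (Phi x) => [v| |]//= _.
rewrite -EFinB lte_fin => aw.
exists [set z | (a + v < dotprod x z)%R].
  have : (a + v < dotprod x w)%R by lra.
  exact: cvgr_gt (@continuous_dotprod R n x w) _.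
move=> z /= az; apply: lt_le_trans (legendre_ge x z).
by rewrite Phix -EFinB lte_fin; lra.
Qed.

Hypothesis Phi_ge0 : forall x, 0 <= Phi x.

Lemma young_le x w (s t : R) : Phi x <= s%:E -> legendre Phi w <= t%:E ->
  (dotprod x w <= s + t)%R.
Proof.
move=> xs /(le_trans (legendre_ge x w)).
move: xs (Phi_ge0 x); case: (Phi x) => [v| |]//=.
by rewrite lee_fin => vs _; rewrite -EFinB lee_fin; lra.
Qed.

(** As [Phi >= 0], [l <x, w> - Phi x <= l (<x, w> - Phi x)]. Together with the homogeneity of
    [grad V] of degree [p - 1], this yields the dilation bound for the dual volumes. *)
Lemma legendre_contract (l : R) w : (0 <= l <= 1)%R ->
  legendre Phi (l *: w) <= l%:E * legendre Phi w.
Proof.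
move=> /andP[l0 l1]; apply: legendre_le => x; rewrite dotprodZr.
apply: (@le_trans _ _ (l%:E * ((dotprod x w)%:E - Phi x))).
  have := Phi_ge0 x; case: (Phi x) => [v| |]//=.
    rewrite lee_fin => v0; rewrite -!EFinB -EFinM lee_fin mulrBr lerB//.
    by rewrite ler_piMl.
  by rewrite addeNy leNye.
by apply: lee_wpmul2l; rewrite ?lee_fin//; exact: legendre_ge.
Qed.

Lemma legendre_ge0 w : Phi 0 = 0 -> 0 <= legendre Phi w.
Proof. by move=> P0; have := legendre_ge 0 w; rewrite P0 dotprod0l sube0. Qed.

Lemma legendre_even w : even_fun Phi -> legendre Phi (- w) = legendre Phi w.
Proof.
move=> ev; apply/eqP; rewrite eq_le; apply/andP; split; apply: legendre_le => x.
  by rewrite dotprodNr -dotprodNl -(ev x); exact: legendre_ge.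
by rewrite -[x]opprK ev dotprodNl -dotprodNr; exact: legendre_ge.
Qed.

End legendre_theory.

(** * Growth and sublevel sets of functions in the class and of their transforms *)

Section classC_theory.
Context {R : realType} {n : nat}.
Local Open Scope ereal_scope.
Variable Phi : 'rV[R]_n -> \bar R.
Hypothesis cPhi : classC Phi.
Hypothesis Phi0 : Phi 0 = 0.
Implicit Types x w : 'rV[R]_n.

Lemma classC_ge0 x : 0 <= Phi x.
Proof.
have h : (0 <= 2^-1 :> R)%R by [].
have h1 : (2^-1 <= 1 :> R)%R by rewrite invf_le1// ler1n.
have := classC_convex cPhi x (- x)%R h h1.
rewrite (classC_even cPhi x) scalerN -scalerBl.
rewrite (_ : 2^-1 - (1 - 2^-1) = 0 :> R)%R; last by field.
rewrite scale0r Phi0; have := classC_gtNy cPhi x; case: (Phi x) => [v _| _|]//.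
by rewrite -!EFinM -EFinD !lee_fin -mulrDl subrKC mul1r.
Qed.

Lemma classC_contract (l : R) x : (0 <= l <= 1)%R -> Phi (l *: x) <= l%:E * Phi x.
Proof.
move=> /andP[l0 l1]; have := classC_convex cPhi x 0%R l0 l1.
by rewrite scaler0 addr0 Phi0 mule0 adde0.
Qed.

(** Beyond some radius the function exceeds [1]; contraction towards the origin, where it vanishes,
    turns this into linear growth. *)
Lemma classC_coercive : exists2 r : R, (0 < r)%R &
  forall x, (r <= enorm x)%R -> (enorm x / r)%:E <= Phi x.
Proof.
have oo1 : nbhs +oo [set y : \bar R | 1 < y] by exact: ereal_nbhs_pinfty_gt.
have [r0 _ r0P] := classC_infty cPhi oo1.
pose r := (Num.max r0 0 + 1)%R.
have rr0 : (r0 < r)%R by rewrite /r ltr_pwDr// le_max lexx.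
have rgt0 : (0 < r)%R by rewrite /r ltr_pwDr// le_max lexx orbT.
exists r => // x rx; have x0 : (0 < enorm x)%R by exact: lt_le_trans rx.
have l01 : (0 <= r / enorm x <= 1)%R.
  by rewrite divr_ge0 ?(ltW rgt0) ?(ltW x0)//= ler_pdivrMr// mul1r.
have : 1 < Phi ((r / enorm x) *: x).
  apply: r0P => /=; rewrite enormZ ger0_norm ?divfK ?gt_eqF//.
  by case/andP: l01.
move=> /lt_le_trans => /(_ _ (classC_contract _ _ l01)).
have := classC_ge0 x; case: (Phi x) => [v| |]; rewrite ?leey//.
rewrite !lee_fin -EFinM lte_fin => v0 h.
rewrite ler_pdivrMr//; move: h; rewrite mulrAC ltr_pdivlMr// mul1r mulrC.
exact: ltW.
Qed.

Lemma classC_sublevel_bounded (s : R) : exists M : R, forall x, Phi x <= s%:E ->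
  forall i, (`|x 0 i| <= M)%R.
Proof.
have [r r0 rP] := classC_coercive.
exists (r + r * `|s|)%R => x xs i; apply: (le_trans (coord_le_enorm _ _)).
have [rx|/ltW xr] := leP r (enorm x); last first.
  by rewrite (le_trans xr)// lerDl mulr_ge0// ltW.
have := le_trans (rP _ rx) xs; rewrite lee_fin ler_pdivrMr// => h.
have := ler_norm s; nra.
Qed.

Lemma classC_legendre_small (t : R) : (0 < t)%R -> exists2 d : R, (0 < d)%R &
  forall w, (\sum_i `|w 0 i| <= d)%R -> legendre Phi w <= t%:E.
Proof.
move=> t0; have [r r0 rP] := classC_coercive.
(* The minimum serves both ranges: inside radius [r] the pairing is at most [t], outside it is at
   most [enorm x / r <= Phi x]. *)
exists (Num.min 1 t / r)%R; first by rewrite divr_gt0// lt_min ltr01.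
move=> w wd; apply: legendre_le => x.
have xw := dotprod_le_enorm x _ _ wd.
have := classC_ge0 x; case Phix : (Phi x) => [v| |]//=; last first.
  by rewrite addeNy leNye.
rewrite lee_fin -EFinB lee_fin => v0.
have [rx|/ltW xr] := leP r (enorm x).
  have := rP _ rx; rewrite Phix lee_fin => xv.
  suff : (enorm x * (Num.min 1 t / r) <= enorm x / r)%R by lra.
  rewrite mulrA ler_pM2r ?invr_gt0// ler_piMr ?sqrtr_ge0//.
  by rewrite ge_min lexx.
suff : (enorm x * (Num.min 1 t / r) <= t)%R by lra.
rewrite mulrA ler_pdivrMr// mulrC; apply: ler_pM; rewrite ?sqrtr_ge0//.
  by rewrite le_min ler01 ltW.
by rewrite ge_min lexx orbT.
Qed.

(** The domain contains a ball around some [x0] and, by symmetry, [- x0]; averaging [x0 + 2 z] with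
    [- x0] gives finiteness at a small [z] on the axis, and contraction lowers the value to [s]. *)
Lemma classC_axis (s : R) (i : 'I_n) : (0 < s)%R -> exists2 e : R, (0 < e)%R &
  Phi (e *: delta_mx 0 i)%R <= s%:E.
Proof.
move=> s0; have [x0 /nbhs_ballP[d /= d0 dP]] := classC_domain cPhi.
pose z : 'rV[R]_n := ((d / 4) *: delta_mx 0 i)%R.
have zoo : Phi z < +oo.
  have h : (0 <= 2^-1 :> R)%R by [].
  have h1 : (2^-1 <= 1 :> R)%R by rewrite invf_le1// ler1n.
  have x0oo : Phi x0 < +oo by apply: dP; exact: ballxx.
  have xzoo : Phi (x0 + 2 *: z) < +oo.
    apply: dP; split=> // k j; rewrite /ball /= !mxE (ord1 k).
    rewrite eqxx ltr_norml /=; case: (j == i); rewrite ?mulr1n ?mulr0n; apply/andP; split; lra.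
  have := classC_convex cPhi (x0 + 2 *: z)%R (- x0)%R h h1.
  rewrite (classC_even cPhi x0).
  rewrite (_ : 2^-1 *: _ + _ = z)%R; last first.
    by apply/rowP => j; rewrite !mxE; field.
  move=> /le_lt_trans; apply.
  move: xzoo x0oo (classC_ge0 (x0 + 2 *: z)%R) (classC_ge0 x0).
  case: (Phi (x0 + 2 *: z)%R) => [u| |]//; case: (Phi x0) => [v| |]// _ _ _ _.
  by rewrite -!EFinM -EFinD ltry.
have := classC_ge0 z; case Phiz : (Phi z) zoo => [v| |]// _; rewrite lee_fin => v0.
have v1 : (0 < v + s)%R by rewrite ltr_wpDl.
pose l := (s / (v + s))%R.
have l0 : (0 < l)%R by exact: divr_gt0.
exists (l * (d / 4))%R; first by rewrite mulr_gt0// divr_gt0.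
rewrite -scalerA; apply: (le_trans (classC_contract _ _ _)).
  by rewrite (ltW l0)/= ler_pdivrMr// mul1r lerDr.
rewrite -/z Phiz -EFinM lee_fin /l mulrAC ler_pdivrMr//.
by rewrite ler_wpM2l ?(ltW s0)// lerDl ltW.
Qed.

(** Young's inequality at axis points of height at most [1], for [w] and [- w], bounds the
    coordinate [i] by [(1 + t) / e i]. *)
Lemma classC_legendre_bounded (t : R) : exists2 C : R, (0 <= C)%R &
  forall w, legendre Phi w <= t%:E -> forall i, (`|w 0 i| <= C)%R.
Proof.
have /choice[e eP] : forall i : 'I_n, exists e : R, (0 < e)%R /\
    Phi (e *: delta_mx 0 i)%R <= 1.
  by move=> i; have [e e0 eP] := classC_axis _ i ltr01; exists e.
exists (\sum_i `|(1 + t) / e i|)%R; first exact: sumr_ge0.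
move=> w wt i; have [e0 ei] := eP i.
have h1 := young_le _ classC_ge0 _ _ _ _ ei wt.
have wt' : legendre Phi (- w) <= t%:E by rewrite legendre_even//; exact: classC_even.
have h2 := young_le _ classC_ge0 _ _ _ _ ei wt'.
rewrite dotprodZl dotprod_delta in h1; rewrite dotprodZl dotprod_delta mxE in h2.
rewrite (bigD1 i)//=; apply: ler_wpDr; first exact: sumr_ge0.
apply: le_trans (ler_norm _); rewrite ler_pdivlMr//.
by have [w0|w0] := leP 0%R (w 0%R i); rewrite ?(ger0_norm w0) ?(ltr0_norm w0); lra.
Qed.

End classC_theory.

(** * Volumes of sublevel sets under dilation *)

Section sublevel_measure.
Context {R : realType} {n : nat}.
Local Open Scope ereal_scope.
Implicit Type th : 'rV[R]_n -> \bar R.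
Let mu := lebesgue_rV R n.

(** For [k = n / p], [s^k] is up to a constant the volume profile of a [p]-homogeneous function; it
    provides the third density for Prekopa-Leindler. *)
Lemma powR_cdf (k : R) : (0 <= k)%R ->
  exists (al : R) (A : R -> R), [/\ (0 < al)%R,
  \int[lebesgue_measure]_(s in `]0%R, +oo[) (expR (- s) * s `^ k)%:E = al%:E,
  forall s : R, (0 < s)%R -> is_derive s 1%R A (expR (- s) * s `^ k / al)%R &
  [/\ forall s : R, (0 < s)%R -> (0 <= A s <= 1)%R,
   forall e : R, (0 < e)%R -> exists2 s : R, (0 < s)%R & (A s < e)%R &
   forall e : R, (0 < e)%R -> exists2 s : R, (0 < s)%R & (1 - e < A s)%R]].
Proof.
move=> k0; apply: (@dilation_cdf R (fun s => s `^ k)%R k k0).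
- by move=> s; exact: powR_gt0.
- move=> s t s0 st; apply: (ge0_ler_powR k0) => //; rewrite nnegrE; first exact: ltW.
  exact/ltW/(lt_le_trans s0).
- move=> s t s0 st; have t0 := lt_le_trans s0 st.
  by rewrite -powRM ?divfK ?gt_eqF// ltW// divr_gt0.
Qed.

Lemma measurable_sublevel th (s : \bar R) :
  measurable_fun setT th -> measurable [set x | th x <= s].
Proof.
by move=> mth; rewrite -[X in measurable X]setTI; exact: emeasurable_fun_infty_c.
Qed.

(** Scaling by [l = (s / t)^(1 / b)] maps [{th <= t}] into [{th <= s}]. The exponent is [b = 1] for
    [Phi] and [b = p - 1] for its dual. *)
Lemma sublevel_dilate_le th (b s t : R) : (0 < b)%R ->
  measurable_fun setT th ->
  (forall (l : R) x, (0 < l <= 1)%R -> th (l *: x)%R <= (l `^ b)%:E * th x) ->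
  (0 < s)%R -> (s <= t)%R ->
  mu [set x | th x <= t%:E] <=
  ((t / s) `^ (n%:R / b))%:E * mu [set x | th x <= s%:E].
Proof.
move=> b0 mth thl s0 st; have t0 := lt_le_trans s0 st.
have st0 : (0 < s / t)%R by exact: divr_gt0.
pose l := ((s / t) `^ b^-1)%R.
have l0 : (0 < l)%R by exact: powR_gt0.
have lb : (l `^ b = s / t)%R by rewrite /l -powRrM mulVf ?gt_eqF// powRr1// ltW.
have l1 : (l <= 1)%R.
  rewrite -(powRr0 (s / t)) /l; apply: ger_powR; rewrite ?invr_ge0 ?(ltW b0)//.
  by rewrite st0/= ler_pdivrMr// mul1r.
apply: (@le_trans _ _ (mu ((fun x => (l *: x)%R) @^-1` [set x | th x <= s%:E]))).
  apply: le_measure; rewrite ?inE.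
  - exact: measurable_sublevel.
  - rewrite -[X in measurable X]setTI; apply: measurable_scale_rV => //.
    exact: measurable_sublevel.
  - move=> x /= xt; apply: (le_trans (thl l x _)); first by rewrite l0.
    rewrite lb; apply: (@le_trans _ _ ((s / t)%:E * t%:E)).
      by apply: lee_wpmul2l => //; rewrite lee_fin ltW.
    by rewrite -EFinM divfK// gt_eqF.
rewrite lebesgue_rV_dilate//; last exact: measurable_sublevel.
suff -> : ((l^-1 ^+ n) = (t / s) `^ (n%:R / b))%R by [].
have -> : (l^-1 = (t / s) `^ b^-1)%R.
  apply: (mulfI (lt0r_neq0 l0)); rewrite divff ?gt_eqF// /l -powRM ?(ltW st0)//.
    by rewrite mulrA divfK ?gt_eqF// divff ?gt_eqF// powR1.
  exact/ltW/divr_gt0.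
by rewrite -powR_mulrn ?powR_ge0// -powRrM (mulrC b^-1%R).
Qed.

Lemma sublevel_dilate_eq th (b s : R) : (0 < b)%R ->
  measurable_fun setT th ->
  (forall (l : R) x, (0 < l)%R -> th (l *: x)%R = (l `^ b)%:E * th x) ->
  (0 < s)%R ->
  mu [set x | th x <= s%:E] = (s `^ (n%:R / b))%:E * mu [set x | th x <= 1].
Proof.
move=> b0 mth thl s0.
pose l := (s `^ (- b^-1))%R.
have l0 : (0 < l)%R by exact: powR_gt0.
have lb : (l `^ b = s^-1)%R by rewrite /l -powRrM mulNr mulVf ?gt_eqF// powR_inv1// ltW.
rewrite (_ : [set x | th x <= s%:E] = (fun x => (l *: x)%R) @^-1` [set x | th x <= 1]).
  rewrite lebesgue_rV_dilate//; last exact: measurable_sublevel.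
  suff -> : ((l^-1 ^+ n) = s `^ (n%:R / b))%R by [].
  by rewrite /l -powRN opprK -powR_mulrn ?powR_ge0// -powRrM mulrC.
apply/seteqP; split=> x /=; rewrite thl// lb.
  move=> xs; apply: (@le_trans _ _ (s^-1%:E * s%:E)).
    by apply: lee_wpmul2l => //; rewrite lee_fin invr_ge0 ltW.
  by rewrite -EFinM mulVf// gt_eqF.
move=> xs; rewrite -[leLHS]mul1e -(@divff _ s) ?gt_eqF// EFinM -muleA.
rewrite -[leRHS]mule1; apply: lee_wpmul2l => //; rewrite lee_fin; exact: ltW.
Qed.

Lemma sublevel_cdf th (b : R) : (0 < b)%R ->
  measurable_fun setT th -> (forall x, 0 <= th x) ->
  (forall (l : R) x, (0 < l <= 1)%R -> th (l *: x)%R <= (l `^ b)%:E * th x) ->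
  (forall s : R, (0 < s)%R -> mu [set x | th x <= s%:E] < +oo) ->
  (exists2 s : R, (0 < s)%R & 0 < mu [set x | th x <= s%:E]) ->
  let F (s : R) := fine (mu [set x | th x <= s%:E]) in
  [/\ forall s : R, (0 < s)%R -> (0 < F s)%R,
   forall s : R, (0 < s)%R -> mu [set x | th x <= s%:E] = (F s)%:E &
  exists (al : R) (A : R -> R), [/\ (0 < al)%R,
  \int[mu]_x expeR (- th x) = al%:E,
  forall s : R, (0 < s)%R -> is_derive s 1%R A (expR (- s) * F s / al)%R &
  [/\ forall s : R, (0 < s)%R -> (0 <= A s <= 1)%R,
   forall e : R, (0 < e)%R -> exists2 s : R, (0 < s)%R & (A s < e)%R &
   forall e : R, (0 < e)%R -> exists2 s : R, (0 < s)%R & (1 - e < A s)%R]]].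
Proof.
move=> b0 mth th0 thl thoo [s1 s10 s1P] F.
have FE (s : R) : (0 < s)%R -> mu [set x | th x <= s%:E] = (F s)%:E.
  by move=> s0; rewrite /F fineK// ge0_fin_numE//; exact: thoo.
have F_nd (s t : R) : (0 < s)%R -> (s <= t)%R -> (F s <= F t)%R.
  move=> s0 st; have t0 := lt_le_trans s0 st; rewrite -lee_fin -!FE//.
  apply: le_measure; rewrite ?inE; try exact: measurable_sublevel.
  by move=> x /= /le_trans; apply; rewrite lee_fin.
have F_dil (s t : R) : (0 < s)%R -> (s <= t)%R -> (F t <= (t / s) `^ (n%:R / b) * F s)%R.
  move=> s0 st; have t0 := lt_le_trans s0 st; rewrite -lee_fin EFinM -!FE//.
  exact: sublevel_dilate_le.
have F1 : (0 < F s1)%R by rewrite -lte_fin -FE.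
have F0 (s : R) : (0 < s)%R -> (0 < F s)%R.
  move=> s0; have [s1s|/ltW ss1] := leP s1 s; first exact: lt_le_trans (F_nd _ _ _ s1s).
  have := lt_le_trans F1 (F_dil _ _ s0 ss1).
  by rewrite pmulr_rgt0// powR_gt0// divr_gt0.
split=> //.
have nb0 : (0 <= n%:R / b)%R by rewrite divr_ge0// ltW.
have [al [A [al0 alE dA AP]]] := @dilation_cdf R F _ nb0 F0 F_nd F_dil.
exists al, A; split=> //.
rewrite layer_cake_expeR// -alE; apply: eq_integral => s.
by rewrite inE/= in_itv/= andbT => s0; rewrite EFinM -FE.
Qed.

(** In the layer cake formula the volume at height [s] is [s^(n / b)] times that at height [1], so
    the integral factors; [ga] is [Gamma (1 + n / b)]. *)
Lemma integral_expeR_homogeneous th (b ga : R) : (0 < b)%R ->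
  measurable_fun setT th -> (forall x, 0 <= th x) ->
  (forall (l : R) x, (0 < l)%R -> th (l *: x)%R = (l `^ b)%:E * th x) ->
  \int[lebesgue_measure]_(s in `]0%R, +oo[) (expR (- s) * s `^ (n%:R / b))%:E = ga%:E ->
  \int[mu]_x expeR (- th x) = ga%:E * mu [set x | th x <= 1].
Proof.
move=> b0 mth th0 thl gaE; rewrite layer_cake_expeR// -gaE.
rewrite -ge0_integralZr//.
- apply: eq_integral => s; rewrite inE/= in_itv/= andbT => s0.
  by rewrite EFinM -muleA; congr (_ * _); exact: sublevel_dilate_eq.
- apply/measurable_EFinP; apply: measurable_funTS; apply: measurable_funM.
    apply: continuous_measurable_fun => z.
    by apply: continuous_comp; [exact: opp_continuous|exact: continuous_expR].
  exact: measurable_powR.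
- by move=> s _; rewrite lee_fin mulr_ge0 ?expR_ge0 ?powR_ge0.
Qed.

End sublevel_measure.

(** * Powers of norms as members of the class *)

Section sublinear.
Context {R : realType} {n : nat}.
Variables (N : 'rV[R]_n -> R) (C e : R).
Hypothesis N_hom : forall (c : R) x, 0 <= c -> N (c *: x) = c * N x.
Hypothesis N_add : forall x y, N (x + y) <= N x + N y.
Hypothesis N_even : forall x, N (- x) = N x.
Hypothesis C_ge0 : 0 <= C.
Hypothesis N_ub : forall x, N x <= C * \sum_i `|x 0 i|.
Hypothesis e_gt0 : 0 < e.
Hypothesis N_lb : forall (x : 'rV[R]_n) (i : 'I_n), e * `|x 0 i| <= N x.

Lemma sublinear0 : N 0 = 0.
Proof. by rewrite -(scale0r 0) N_hom// mul0r. Qed.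

Lemma sublinear_ge0 x : 0 <= N x.
Proof. by have := N_add x (- x); rewrite subrr sublinear0 N_even; lra. Qed.

Lemma sublinear_lipschitz x y : `|N x - N y| <= C * n%:R * `|x - y|.
Proof.
have ub z : N z <= C * n%:R * `|z|.
  apply: (le_trans (N_ub z)); rewrite -mulrA ler_wpM2l//.
  apply: (@le_trans _ _ (\sum_(i < n) `|z|)).
    apply: ler_sum => i _.
    by rewrite [leRHS]mx_normrE (le_trans _ (le_bigmax _ _ (0, i))).
  by rewrite sumr_const card_ord mulr_natl.
have h1 := N_add (x - y) y; have h2 := N_add (y - x) x.
have u1 := ub (x - y); have u2 := ub (y - x).
rewrite !subrK in h1 h2; rewrite (distrC y) in u2.
by rewrite ler_norml; apply/andP; split; lra.
Qed.

Lemma sublinear_continuous : continuous N.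
Proof.
move=> x; apply/(@cvgrPdist_le _ R _ (nbhs x)) => d d0.
pose K := C * n%:R + 1.
have K0 : 0 < K by rewrite ltr_wpDl// mulr_ge0.
near=> y; apply: (le_trans (sublinear_lipschitz x y)).
have xy : `|x - y| <= d / K.
  near: y; apply: (@cvgr_dist_le _ _ _ (nbhs x) _ id x); first exact: cvg_id.
  exact: divr_gt0.
apply: (@le_trans _ _ (K * `|x - y|)); first by rewrite ler_wpM2r// lerDl.
by rewrite -ler_pdivlMl// mulrC.
Unshelve. all: by end_near. Qed.

Lemma enorm_le_sublinear x : e * enorm x <= n%:R * N x.
Proof.
apply: (@le_trans _ _ (e * \sum_i `|x 0 i|)).
  by rewrite ler_wpM2l ?(ltW e_gt0)// enorm_le_sum.
rewrite mulr_sumr; apply: (@le_trans _ _ (\sum_(i < n) N x)).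
  by apply: ler_sum => i _.
by rewrite sumr_const card_ord mulr_natl.
Qed.

Lemma sublinear_powR_classC (p c : R) : 1 < p -> 0 < c ->
  classC (fun x => (c * N x `^ p)%:E).
Proof.
move=> p1 c0; have p0 : 0 < p by lra.
split.
- by move=> x; rewrite ltNyr.
- move=> x a; rewrite lte_fin => ax.
  (* A negative [a] lies below the function everywhere; otherwise [N x > 0], and the real power is
     differentiable at [N x]. *)
  have [a0|a0] := ltP a 0.
    exists setT; first exact: filterT.
    by move=> y _; rewrite lte_fin (lt_le_trans a0)// mulr_ge0 ?(ltW c0)// powR_ge0.
  have Nx0 : 0 < N x.
    rewrite lt_def sublinear_ge0 andbT; apply: contraTN ax => /eqP ->.
    by rewrite powR0 ?gt_eqF// mulr0 -leNgt.
  exists [set y | a < c * N y `^ p]; last by move=> y /=; rewrite lte_fin.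
  have cf : {for x, continuous (fun y => c * N y `^ p)}.
    apply: continuousM; first exact: cst_continuous.
    apply: (@continuous_comp _ _ _ N (fun r : R => r `^ p)); first exact: sublinear_continuous.
    apply/differentiable_continuous/derivable1_diffP/derivable_powR.
    by rewrite in_itv/= andbT.
  exact: cvgr_gt cf _ ax.
- by move=> x; rewrite N_even.
- move=> x y t t0 t1; rewrite -!EFinM -EFinD lee_fin.
  have cvx : N (t *: x + (1 - t) *: y) <= t * N x + (1 - t) * N y.
    by apply: (le_trans (N_add _ _)); rewrite !N_hom// subr_ge0.
  have cp : (t * N x + (1 - t) * N y) `^ p <= t * N x `^ p + (1 - t) * N y `^ p.
    pose ti : {i01 R} := Itv01 t0 t1.
    have := @convex_powR R p (ltW p1) ti (N x) (N y).
    rewrite !inE/= !in_itv/= !andbT => /(_ (sublinear_ge0 x) (sublinear_ge0 y)).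
    by rewrite !convRE /=; apply.
  apply: (@le_trans _ _ (c * (t * N x `^ p + (1 - t) * N y `^ p))).
    rewrite ler_pM2l//; apply: le_trans cp.
    apply: ge0_ler_powR => //; rewrite ?nnegrE ?sublinear_ge0//; first exact: ltW.
    by rewrite addr_ge0// mulr_ge0 ?sublinear_ge0// subr_ge0.
  by rewrite le_eqVlt; apply/orP; left; apply/eqP; ring.
- exists 0; rewrite (_ : [set x | _] = setT) ?interiorT//.
  by apply/seteqP; split=> x //= _; exact: ltry.
- have FF : Filter (@enorm_infty R n).
    apply: filter_from_filter; first by exists 0.
    by move=> i j _ _; exists (Num.max i j) => // x /=; rewrite gt_max => /andP[].
  apply/cvgeyPge => A.
  (* By [enorm_le_sublinear] this radius forces [N x > max(1, A / c)]; exceeding [1] gives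
     [N x <= N x^p]. *)
  pose r := Num.max 1 (A / c) * n%:R / e.
  exists r => // x /= rx; rewrite lee_fin.
  have Nx : Num.max 1 (A / c) < N x.
    have := enorm_le_sublinear x; rewrite mulrC.
    move: rx; rewrite /r ltr_pdivrMr// => /lt_le_trans /[apply].
    have := ler0n R n; rewrite le_eqVlt => /predU1P[<-|n0].
      by rewrite mulr0 mul0r ltxx.
    by rewrite mulrC ltr_pM2l.
  move: Nx; rewrite gt_max => /andP[N1 NA].
  rewrite ltr_pdivrMr// in NA.
  have : N x <= N x `^ p by rewrite le1r_powR//; exact: ltW.
  by rewrite -(ler_pM2l c0); lra.
Qed.

End sublinear.

(** * Support functions of bounded symmetric sets *)

Section support_function.
Context {R : realType} {n : nat}.
Variables (W : set 'rV[R]_n) (C e : R).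
Hypothesis W0 : W 0.
Hypothesis W_sym : forall w, W w -> W (- w).
Hypothesis C_ge0 : 0 <= C.
Hypothesis W_bounded : forall w, W w -> forall i, `|w 0 i| <= C.
Hypothesis e_gt0 : 0 < e.
Hypothesis W_axis : forall i, W (e *: delta_mx 0 i).

Definition support_fun (x : 'rV[R]_n) : R := sup [set dotprod x w | w in W].

Let dot_le x w : W w -> dotprod x w <= C * \sum_i `|x 0 i|.
Proof.
move=> Ww; rewrite mulr_sumr; apply: ler_sum => i _.
apply: (le_trans (ler_norm _)); rewrite normrM mulrC.
by apply: ler_pM => //; exact: W_bounded.
Qed.

Let support_has_sup x : has_sup [set dotprod x w | w in W].
Proof.
split; first by exists (dotprod x 0), 0.
by exists (C * \sum_i `|x 0 i|) => _ [w Ww <-]; exact: dot_le.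
Qed.

Lemma support_ge x w : W w -> dotprod x w <= support_fun x.
Proof. by move=> Ww; apply: (sup_upper_bound (support_has_sup x)); exists w. Qed.

Lemma support_le x (a : R) : (forall w, W w -> dotprod x w <= a) -> support_fun x <= a.
Proof.
move=> h; apply: ge_sup; first by exists (dotprod x 0), 0.
by move=> _ [w Ww <-]; exact: h.
Qed.

Lemma support_hom (c : R) x : 0 <= c -> support_fun (c *: x) = c * support_fun x.
Proof.
have le (d : R) y : 0 <= d -> support_fun (d *: y) <= d * support_fun y.
  move=> d0; apply: support_le => w Ww; rewrite dotprodZl ler_wpM2l//.
  exact: support_ge.
rewrite le_eqVlt => /predU1P[<-|c0].
  apply/eqP; rewrite eq_le le//= mul0r scale0r.
  by have := support_ge 0 _ W0; rewrite dotprod0l.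
apply/eqP; rewrite eq_le le ?(ltW c0)//=.
rewrite -[in leLHS](scale1r x) -(@mulVf _ c) ?gt_eqF// -scalerA.
have ci : 0 <= c^-1 by rewrite invr_ge0 ltW.
have := le _ (c *: x) ci; rewrite -(ler_pM2l c0) mulrA divff ?gt_eqF// mul1r.
by [].
Qed.

Lemma support_add x y : support_fun (x + y) <= support_fun x + support_fun y.
Proof.
by apply: support_le => w Ww; rewrite dotprodDl lerD// support_ge.
Qed.

Lemma support_even x : support_fun (- x) = support_fun x.
Proof.
have le y : support_fun (- y) <= support_fun y.
  apply: support_le => w Ww; rewrite dotprodNl -dotprodNr.
  exact/support_ge/W_sym.
by apply/eqP; rewrite eq_le le/= -[in leLHS](opprK x).
Qed.

Lemma support_ub x : support_fun x <= C * \sum_i `|x 0 i|.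
Proof. by apply: support_le => w; exact: dot_le. Qed.

Lemma support_lb (x : 'rV[R]_n) (i : 'I_n) : e * `|x 0 i| <= support_fun x.
Proof.
have dE (y : 'rV[R]_n) : dotprod y (e *: delta_mx 0 i) = e * y 0 i.
  by rewrite dotprodZr dotprodC dotprod_delta.
have [x0|x0] := leP 0 (x 0 i).
  by rewrite ger0_norm// -dE; exact: support_ge.
by rewrite ltr0_norm// mulrN -dE -dotprodNr; exact/support_ge/W_sym.
Qed.

End support_function.

Lemma powRV {R : realType} (a q : R) : 0 <= a -> a^-1 `^ q = (a `^ q)^-1.
Proof. by move=> a0; rewrite -powR_inv1// -powRrM mulN1r powRN. Qed.

(** * Volume profiles of the maximizer and of its dual *)

Section maximizer.
Context {R : realType} {n : nat}.
Variables (p : R) (V : 'rV[R]_n -> R) (Phi : 'rV[R]_n -> \bar R).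
Hypothesis p_gt1 : 1 < p.
Hypothesis V_even : even_fun V.
Hypothesis V_sc : strictly_convex V.
Hypothesis V_hom : p_homogeneous p (fun x => (V x)%:E).
Hypothesis V_C1 : Ck_on 1 (~` [set 0]) V.
Let mu := lebesgue_rV R n.
Let p1_gt0 : 0 < p - 1. Proof. by rewrite subr_gt0. Qed.
Let p_gt0 : 0 < p. Proof. by have := p_gt1; lra. Qed.

Let grad_hom (l : R) y : 0 < l -> grad V (l *: y) = l `^ (p - 1) *: grad V y.
Proof. by move=> l0; rewrite (grad_homogeneousE p V p_gt1 V_even V_hom V_C1). Qed.

Let dual (Psi : 'rV[R]_n -> \bar R) (y : 'rV[R]_n) : \bar R :=
  (((p - 1)^-1)%:E * legendre Psi (grad V y))%E.

Let dual_measurable (Psi : 'rV[R]_n -> \bar R) : classC Psi ->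
  measurable_fun setT (dual Psi).
Proof.
move=> cPsi; apply: measurable_funeM.
apply: (measurableT_comp (f := legendre Psi)).
  apply: lsc_measurable_rV; apply: legendre_lsc => x.
  exact: (classC_gtNy cPsi).
exact: (measurable_grad V V_C1).
Qed.

Let dual_ge0 (Psi : 'rV[R]_n -> \bar R) : Psi 0 = 0%E -> forall y, (0 <= dual Psi y)%E.
Proof.
move=> Psi0 y; apply: mule_ge0; last exact: legendre_ge0.
by rewrite lee_fin invr_ge0 ltW.
Qed.

Let dual_le (Psi : 'rV[R]_n -> \bar R) y (s : R) :
  (dual Psi y <= s%:E)%E = (legendre Psi (grad V y) <= ((p - 1) * s)%:E)%E.
Proof. by rewrite /dual lee_pdivrMl// EFinM. Qed.

Lemma exists_measure_gt0 (U : set 'rV[R]_n) (E : nat -> set 'rV[R]_n) :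
  measurable U -> (0 < mu U)%E -> (forall k, measurable (E k)) ->
  U `<=` \bigcup_k E k -> exists k, (0 < mu (E k))%E.
Proof.
move=> mU U0 mE UE; apply: contrapT => /forallNP noE.
have : mu.-negligible U.
  apply: (@negligibleS _ _ _ _ (\bigcup_k E k)) => //.
  apply: negligible_bigcup => k; apply/negligibleP => //.
  by apply/eqP; rewrite eq_le measure_ge0 andbT leNgt; apply/negP/noE.
by move/negligibleP => /(_ mU) U00; move: U0; rewrite U00 ltxx.
Qed.

Section dilation_data.
Hypothesis cPhi : classC Phi.
Hypothesis Phi0 : Phi 0 = 0%E.

Lemma classC_sublevel_gt0 : exists2 s : R, 0 < s & (0 < mu [set x | (Phi x <= s%:E)%E])%E.
Proof.
have mPhi := lsc_measurable_rV _ _ (classC_lsc cPhi).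
have oU : open [set x | (Phi x < +oo)%E]° by exact: open_interior.
have [|k kP] := exists_measure_gt0 _ (fun k => [set x | (Phi x <= k.+1%:R%:E)%E])
  (open_measurable_rV _ _ oU) (lebesgue_rV_open_gt0 _ _ oU (classC_domain cPhi))
  (fun k => measurable_sublevel _ _ mPhi).
  2: by exists k.+1%:R.
move=> x /interior_subset/=; have := classC_ge0 _ cPhi Phi0 x.
case Phix : (Phi x) => [v| |]// v0 _; exists (Num.truncn v) => //=.
by rewrite Phix lee_fin ltW// truncnS_gt.
Qed.

(** The behaviour of [grad V] near the origin is reached by scaling: the sublevel sets of
    [sum_i |grad V y_i|] cover the space, so one has positive measure, and homogeneity of degree
    [p - 1] transfers this to the height [d] at which [Phi^*] is at most [p - 1]. *)
Lemma dual_sublevel_gt0 : (0 < mu [set y | (dual Phi y <= 1%:E)%E])%E.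
Proof.
have mdual := dual_measurable _ cPhi.
have [d d0 dP] := classC_legendre_small _ cPhi Phi0 _ p1_gt0.
pose th (y : 'rV[R]_n) : \bar R := (\sum_i `|grad V y 0 i|)%:E.
have mth : measurable_fun setT th.
  apply/measurable_EFinP; apply: measurable_sum => i.
  apply: measurableT_comp => //.
  by apply: (measurableT_comp (measurable_coord i)); exact: (measurable_grad V V_C1).
have thl (l : R) x : 0 < l <= 1 -> (th (l *: x) <= (l `^ (p - 1))%:E * th x)%E.
  move=> /andP[l0 l1]; rewrite /th -EFinM lee_fin mulr_sumr; apply: ler_sum => i _.
  by rewrite grad_hom// mxE normrM ger0_norm// powR_ge0.
have [k kP] : exists k : nat, (0 < mu [set x | (th x <= (d + k%:R)%:E)%E])%E.
  apply: (exists_measure_gt0 setT) => //.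
  - by apply: lebesgue_rV_open_gt0; [exact: openT|exists 0].
  - by move=> k; exact: measurable_sublevel.
  - move=> x _; exists (Num.truncn (\sum_i `|grad V x 0 i|)).+1 => //=.
    by rewrite lee_fin ler_wpDl ?(ltW d0)// ltW// truncnS_gt.
have dk : d <= d + k%:R by rewrite lerDl.
have := lt_le_trans kP (sublevel_dilate_le th (p - 1) d _ p1_gt0 mth thl d0 dk).
move=> h; have {}h : (0 < mu [set x | (th x <= d%:E)%E])%E.
  rewrite lt_neqAle measure_ge0 andbT; apply: contraTN h => /eqP <-.
  by rewrite mule0 ltxx.
apply: (lt_le_trans h); apply: le_measure; rewrite ?inE; try exact: measurable_sublevel.
by move=> y /=; rewrite dual_le mulr1 lee_fin => /dP.
Qed.

Let F (s : R) := fine (mu [set x | (Phi x <= s%:E)%E]).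
Let G (s : R) := fine (mu [set y | (dual Phi y <= s%:E)%E]).

Lemma classC_cdf : [/\ forall s : R, 0 < s -> 0 < F s,
   forall s : R, 0 < s -> mu [set x | (Phi x <= s%:E)%E] = (F s)%:E &
  exists (al : R) (A : R -> R), [/\ 0 < al,
  (\int[mu]_x expeR (- Phi x))%E = al%:E,
  forall s : R, 0 < s -> is_derive s 1 A (expR (- s) * F s / al) &
  [/\ forall s : R, 0 < s -> 0 <= A s <= 1,
   forall e : R, 0 < e -> exists2 s : R, 0 < s & A s < e &
   forall e : R, 0 < e -> exists2 s : R, 0 < s & 1 - e < A s]]].
Proof.
have mPhi := lsc_measurable_rV _ _ (classC_lsc cPhi).
apply: (sublevel_cdf Phi 1 ltr01 mPhi (classC_ge0 _ cPhi Phi0)).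
- move=> l x /andP[l0 l1]; rewrite powRr1 ?(ltW l0)//.
  by apply: classC_contract => //; rewrite (ltW l0).
- move=> s s0; have [M MP] := classC_sublevel_bounded _ cPhi Phi0 s.
  by apply: (lebesgue_rV_bounded_lty _ M) => //; exact: measurable_sublevel.
- exact: classC_sublevel_gt0.
Qed.

Lemma dual_cdf : [/\ forall s : R, 0 < s -> 0 < G s,
   forall s : R, 0 < s -> mu [set y | (dual Phi y <= s%:E)%E] = (G s)%:E &
  exists (al : R) (A : R -> R), [/\ 0 < al,
  (\int[mu]_y expeR (- dual Phi y))%E = al%:E,
  forall s : R, 0 < s -> is_derive s 1 A (expR (- s) * G s / al) &
  [/\ forall s : R, 0 < s -> 0 <= A s <= 1,
   forall e : R, 0 < e -> exists2 s : R, 0 < s & A s < e &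
   forall e : R, 0 < e -> exists2 s : R, 0 < s & 1 - e < A s]]].
Proof.
have mdual := dual_measurable _ cPhi.
apply: (sublevel_cdf (dual Phi) (p - 1) p1_gt0 mdual (dual_ge0 _ Phi0)).
- move=> l y /andP[l0 l1]; rewrite /dual grad_hom// muleCA.
  apply: lee_wpmul2l; first by rewrite lee_fin invr_ge0 ltW.
  apply: legendre_contract; first exact: classC_ge0.
  rewrite powR_ge0/= -[leRHS](powRr0 l); apply: ger_powR; first by rewrite l0.
  exact: ltW.
- move=> s s0; have [C C0 CP] := classC_legendre_bounded _ cPhi Phi0 ((p - 1) * s).
  have [M MP] := grad_homogeneous_bounded p V p_gt1 V_even V_sc V_hom V_C1 C.
  apply: (lebesgue_rV_bounded_lty _ M); first exact: measurable_sublevel.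
  by move=> y /=; rewrite dual_le => /CP yC; exact: MP.
- by exists 1 => //; exact: dual_sublevel_gt0.
Qed.

End dilation_data.

(** The substitution [x = c x'] gives one inequality for every [c > 0]; taking [c = l^-1] at the
    rescaled point reverses it. With [grad_hom], [dual Psi] is then homogeneous of degree [p]. *)
Lemma legendre_homogeneous (Psi : 'rV[R]_n -> \bar R) (l : R) w : 0 < l ->
  (forall (c : R) x, 0 < c -> Psi (c *: x) = ((c `^ p)%:E * Psi x)%E) ->
  legendre Psi (l `^ (p - 1) *: w) = ((l `^ p)%:E * legendre Psi w)%E.
Proof.
move=> + Psi_hom.
have le (c : R) z : 0 < c ->
    (legendre Psi (c `^ (p - 1) *: z) <= (c `^ p)%:E * legendre Psi z)%E.
  move=> c0; apply: legendre_le => x.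
  have -> : x = c *: (c^-1 *: x) by rewrite scalerA divff ?gt_eqF// scale1r.
  set x' := c^-1 *: x; rewrite Psi_hom// dotprodZr dotprodZl mulrA (mulrC _ c).
  rewrite mulr_powRB1 ?(ltW c0)// EFinM -muleBr ?fin_num_adde_defr//.
  by apply: lee_wpmul2l; [rewrite lee_fin powR_ge0|exact: legendre_ge].
move=> l0; apply/eqP; rewrite eq_le le//=.
have li : 0 < l^-1 by rewrite invr_gt0.
have := le _ (l `^ (p - 1) *: w) li.
rewrite scalerA !powRV ?(ltW l0)// mulVf ?gt_eqF ?powR_gt0// scale1r.
by rewrite lee_pdivlMl ?powR_gt0.
Qed.

(** * Comparison of the maximizer with homogeneous competitors *)

Section comparison.
Hypothesis cPhi : classC Phi.
Hypothesis Phi0 : Phi 0 = 0%E.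
Hypothesis Phi_max : forall Psi : 'rV[R]_n -> \bar R,
  classC Psi -> (BS p V Psi <= BS p V Phi)%E.

Let F (s : R) := fine (mu [set x | (Phi x <= s%:E)%E]).
Let G (s : R) := fine (mu [set y | (dual Phi y <= s%:E)%E]).

Variables al be ga : R.
Hypothesis ga_gt0 : 0 < ga.
Hypothesis alE : (\int[mu]_x expeR (- Phi x))%E = al%:E.
Hypothesis beE : (\int[mu]_y expeR (- dual Phi y))%E = be%:E.
Hypothesis gaE : (\int[lebesgue_measure]_(s in `]0%R, +oo[)
  (expR (- s) * s `^ (n%:R / p))%:E)%E = ga%:E.

Let kap := n%:R / p.

(** AM-GM at [x = a^p]; geometrically, the tangent line of [a^p] at [a = 1]. *)
Let bernoulli_powR (a : R) : 0 <= a -> p * a <= a `^ p + (p - 1).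
Proof.
rewrite le_eqVlt => /predU1P[<-|a0]; first by rewrite powR0 ?gt_eqF// mulr0 add0r ltW.
have lam01 : 0 < 1 - p^-1 < 1.
  by rewrite subr_gt0 invf_lt1// p_gt1/= gtrBl invr_gt0.
have [+ _] := powR_le_affine (1 - p^-1) (a `^ p) lam01 (powR_gt0 _ a0).
rewrite opprB addrCA subrr addr0 -powRrM divff ?gt_eqF// powRr1 ?(ltW a0)//.
rewrite -(ler_pM2l p_gt0) mulrDr mulrBr mulr1 divff ?gt_eqF// mulrA divff ?gt_eqF// mul1r.
by lra.
Qed.

(* N is the support function of {w | Phi^*(p t w) <= (p - 1) t} and the competitor
   is t N^p. Young's inequality puts {Phi <= s} in a dilate of {N <= 1}, while
   [p a <= a^p + (p - 1)] puts {dual Phi <= t} in {dual (t N^p) <= t}. *)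
Lemma comparison (t : R) : 0 < t -> exists (N : 'rV[R]_n -> R) (m1 : R),
  [/\ continuous N, forall (c : R) x, 0 <= c -> N (c *: x) = c * N x,
   mu [set x | N x <= 1] = m1%:E,
   forall (s : R) x, (Phi x <= s%:E)%E -> N x <= (s + (p - 1) * t) / (p * t) &
   (ga * (t `^ (- kap) * m1)) * (ga * (t `^ (- kap) * G t)) `^ (p - 1) <=
   al * be `^ (p - 1)].
Proof.
move=> t0; have pt0 : 0 < p * t by rewrite mulr_gt0.
have p1t0 : 0 < (p - 1) * t by rewrite mulr_gt0.
have Phi_ge0 := classC_ge0 _ cPhi Phi0.
have Phi_even := classC_even cPhi.
pose W := [set w : 'rV[R]_n | (legendre Phi ((p * t) *: w) <= ((p - 1) * t)%:E)%E].
have [d d0 dP] := classC_legendre_small _ cPhi Phi0 _ p1t0.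
have [C C0 CP] := classC_legendre_bounded _ cPhi Phi0 ((p - 1) * t).
have W0 : W 0.
  by apply: dP; rewrite scaler0 big1 ?(ltW d0)// => i _; rewrite mxE normr0.
have W_sym w : W w -> W (- w).
  by rewrite /W /= scalerN legendre_even.
have Cpt_ge0 : 0 <= C / (p * t) by rewrite divr_ge0// ltW.
have W_bounded w : W w -> forall i, `|w 0 i| <= C / (p * t).
  move=> /CP wC i; rewrite ler_pdivlMr// mulrC.
  by have := wC i; rewrite mxE normrM (gtr0_norm pt0).
have dpt_gt0 : 0 < d / (p * t) by rewrite divr_gt0.
have W_axis i : W ((d / (p * t)) *: delta_mx 0 i).
  apply: dP; rewrite scalerA mulrC divfK ?gt_eqF// (bigD1 i)//= big1 ?addr0.
    by rewrite !mxE !eqxx mulr1 gtr0_norm.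
  by move=> j ji; rewrite !mxE (negbTE ji) andbF mulr0 normr0.
pose N := support_fun W.
have N_hom := support_hom W _ W0 W_bounded.
have N_add := support_add W _ W0 W_bounded.
have N_even := support_even W _ W0 W_sym W_bounded.
have N_ub := support_ub W _ W0 W_bounded.
have N_lb := support_lb W _ _ W0 W_sym W_bounded W_axis.
rewrite -/N in N_hom N_add N_even N_ub N_lb.
have N_cont : continuous N := sublinear_continuous _ _ N_add Cpt_ge0 N_ub.
have N_ge0 := sublinear_ge0 _ N_hom N_add N_even.
pose Psi (x : 'rV[R]_n) : \bar R := (t * N x `^ p)%:E.
have cPsi : classC Psi.
  exact: (sublinear_powR_classC N _ _ N_hom N_add N_even Cpt_ge0 N_ub dpt_gt0 N_lb).
have Psi_hom (c : R) x : 0 < c -> Psi (c *: x) = ((c `^ p)%:E * Psi x)%E.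
  by move=> c0; rewrite /Psi N_hom ?(ltW c0)// powRM ?(ltW c0)// -EFinM mulrCA.
have Psi0 : Psi 0 = 0%E.
  by rewrite /Psi (sublinear0 _ N_hom) powR0 ?gt_eqF// mulr0.
have Psi_ge0 := classC_ge0 _ cPsi Psi0.
have mPsi := lsc_measurable_rV _ _ (classC_lsc cPsi).
have mdual := dual_measurable _ cPhi.
have mdualPsi := dual_measurable _ cPsi.
have dualPsi_hom (c : R) y : 0 < c -> dual Psi (c *: y) = ((c `^ p)%:E * dual Psi y)%E.
  by move=> c0; rewrite /dual grad_hom// legendre_homogeneous// muleCA.
(* This makes [m1] the volume of the competitor at height [t]; [dilt] brings the height of both
   profiles from [t] to [1]. *)
have sub1 : [set x | N x <= 1] = [set x | (Psi x <= t%:E)%E].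
  have onep : 1 `^ p = 1 :> R by rewrite powR1.
  apply/seteqP; split=> x /=; rewrite /Psi lee_fin ger_pMr//.
    move=> N1; rewrite -[leRHS]onep.
    by apply: (ge0_ler_powR (ltW p_gt0)); rewrite ?nnegrE.
  move=> Np1; rewrite leNgt; apply/negP => N1.
  have := le1r_powR (ltW N1) (ltW p_gt1); lra.
have [m1 m1E] : exists m1 : R, mu [set x | N x <= 1] = m1%:E.
  exists (fine (mu [set x | N x <= 1])); rewrite fineK// ge0_fin_numE//.
  apply: (lebesgue_rV_bounded_lty _ (d / (p * t))^-1).
    by rewrite sub1; exact: measurable_sublevel.
  by move=> x /= N1 i; rewrite -[leRHS]mul1r ler_pdivlMr// mulrC (le_trans (N_lb x i)).
exists N, m1; split => //.
  move=> s x xs; apply: support_le => // w Ww.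
  rewrite ler_pdivlMr// mulrC -dotprodZr.
  exact: (young_le _ Phi_ge0 _ _ _ _ xs Ww).
have tkap : t `^ (- kap) * t `^ kap = 1.
  by rewrite powRN mulVf// gt_eqF// powR_gt0.
have dilt (th : 'rV[R]_n -> \bar R) : measurable_fun setT th ->
    (forall (c : R) x, 0 < c -> th (c *: x) = ((c `^ p)%:E * th x)%E) ->
    mu [set x | (th x <= 1)%E] = ((t `^ (- kap))%:E * mu [set x | (th x <= t%:E)%E])%E.
  move=> mth th_hom.
  rewrite (sublevel_dilate_eq th p t p_gt0 mth th_hom t0) muleA -EFinM.
  by rewrite tkap mul1e.
have PsiE : (\int[mu]_x expeR (- Psi x))%E = (ga * (t `^ (- kap) * m1))%:E.
  rewrite (integral_expeR_homogeneous Psi p ga p_gt0 mPsi Psi_ge0 Psi_hom gaE).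
  by rewrite -/mu (dilt _ mPsi Psi_hom) -sub1 m1E -!EFinM.
have dualE : ((ga * (t `^ (- kap) * G t))%:E <= \int[mu]_x expeR (- dual Psi x))%E.
  rewrite (integral_expeR_homogeneous (dual Psi) p ga p_gt0 mdualPsi
    (dual_ge0 _ Psi0) dualPsi_hom gaE).
  rewrite -/mu (dilt _ mdualPsi dualPsi_hom) EFinM lee_pmul2l// EFinM.
  rewrite lee_pmul2l ?lte_fin ?powR_gt0//.
  have [_ <- // _] := dual_cdf cPhi Phi0.
  apply: le_measure; rewrite ?inE; try exact: measurable_sublevel.
  move=> y /=; rewrite !dual_le => yt; apply: legendre_le => x.
  set w := grad V y in yt *.
  (* [W] is [{Phi^* <= (p - 1) t}] shrunk by [p t], so
     [<x, w> <= p t N x <= t N x^p + (p - 1) t]. *)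
  have Ww : W ((p * t)^-1 *: w).
    by rewrite /W /= scalerA divff ?gt_eqF// scale1r.
  have := support_ge W _ W0 W_bounded x _ Ww.
  rewrite -/N dotprodZr /Psi -EFinB lee_fin ler_pdivrMl// => xw.
  have bern := bernoulli_powR _ (N_ge0 x).
  have := ler_wpM2l (ltW t0) bern; lra.
have := Phi_max Psi cPsi.
have BSPhi : BS p V Phi = (al * be `^ (p - 1))%:E.
  by rewrite /BS alE -[X in (_ * X `^ _)%E]/(\int[mu]_y expeR (- dual Phi y))%E beE poweR_EFin.
rewrite BSPhi => M; rewrite -lee_fin; apply: le_trans M.
rewrite /BS PsiE EFinM; apply: lee_wpmul2l.
  rewrite lee_fin !mulr_ge0 ?powR_ge0 ?(ltW ga_gt0)//.
  by rewrite -lee_fin -m1E measure_ge0.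
rewrite -poweR_EFin; apply: gt0_ler_poweR; rewrite ?(ltW p1_gt0)//.
- rewrite in_itv/= leey andbT lee_fin; apply: mulr_ge0; first exact: ltW.
  by rewrite mulr_ge0 ?powR_ge0// fine_ge0// measure_ge0.
- by rewrite in_itv/= leey andbT integral_ge0// => x _; exact: expeR_ge0.
Qed.

Let pow_factor (tau g : R) (m : R) : 0 <= tau -> 0 <= g ->
  (ga * (tau * m)) * (ga * (tau * g)) `^ (p - 1) =
  ga `^ p * tau `^ p * (m * g `^ (p - 1)).
Proof.
move=> tau0 g0; rewrite !powRM ?mulr_ge0 ?(ltW ga_gt0)//.
by rewrite -(@mulr_powRB1 _ ga p) ?(ltW ga_gt0)// -(@mulr_powRB1 _ tau p)//; ring.
Qed.

(** Since [kap p = n], the two scaling factors combine to [t^(- kap p) = t^(- n)], and the two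
    constants to [ga^p]. *)
Let level_bound (t m : R) : 0 < t ->
  (ga * (t `^ (- kap) * m)) * (ga * (t `^ (- kap) * G t)) `^ (p - 1) <=
    al * be `^ (p - 1) ->
  m * G t `^ (p - 1) <= al * be `^ (p - 1) / ga `^ p * t ^+ n.
Proof.
move=> t0; have [G0 _ _] := dual_cdf cPhi Phi0.
rewrite pow_factor ?powR_ge0 ?(ltW (G0 _ t0))//.
have tn0 : 0 < t ^+ n by exact: exprn_gt0.
have gp0 : 0 < ga `^ p by exact: powR_gt0.
have -> : (t `^ (- kap)) `^ p = (t ^+ n)^-1.
  by rewrite -powRrM mulNr /kap divfK ?gt_eqF// powRN powR_mulrn// ltW.
move=> h; rewrite mulrAC ler_pdivlMr// -ler_pdivrMr//.
by apply: le_trans h; rewrite le_eqVlt; apply/orP; left; apply/eqP; field; rewrite !gt_eqF.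
Qed.

Let measurable_le1 (N : 'rV[R]_n -> R) (r : R) : continuous N ->
  measurable [set x | N x <= r].
Proof.
move=> cN; rewrite (_ : [set x | _] = ~` (N @^-1` `]r, +oo[%classic)).
  apply: measurableC; apply: open_measurable_rV.
  by apply: open_comp => // x _; exact: cN.
by apply/seteqP; split=> x /=; rewrite in_itv/= andbT leNgt => /negP.
Qed.

(** [{Phi <= s}] lies in [rho {N <= 1}], so [F s <= rho^n m1]; then [rho t = (s + (p - 1) t) / p]
    absorbs the factor [t^n] of [level_bound]. *)
Lemma level_inequality (s t : R) : 0 < s -> 0 < t ->
  F s * G t `^ (p - 1) <=
  al * be `^ (p - 1) / ga `^ p * ((s + (p - 1) * t) / p) ^+ n.
Proof.
move=> s0 t0; have [N [m1 [cN N_hom m1E NP /(level_bound _ _ t0) mG]]] := comparison t t0.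
have [G0 _ _] := dual_cdf cPhi Phi0.
have [_ FE _] := classC_cdf cPhi Phi0.
pose rho := (s + (p - 1) * t) / (p * t).
have u0 : 0 < s + (p - 1) * t by rewrite addr_gt0// mulr_gt0.
have rho0 : 0 < rho by rewrite divr_gt0// mulr_gt0.
have Fm : F s <= rho ^+ n * m1.
  rewrite -lee_fin -FE// EFinM -m1E.
  have -> : rho ^+ n = (rho^-1)^-1 ^+ n by rewrite invrK.
  rewrite -lebesgue_rV_dilate ?invr_gt0//; last exact: measurable_le1.
  apply: le_measure; rewrite ?inE.
  - by apply: measurable_sublevel; apply: lsc_measurable_rV; exact: (classC_lsc cPhi).
  - rewrite -[X in measurable X]setTI; apply: measurable_scale_rV => //.
    exact: measurable_le1.
  - move=> x /NP Nx /=; rewrite N_hom ?invr_ge0 ?(ltW rho0)//.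
    by rewrite mulrC ler_pdivrMr// mul1r.
have Gp := powR_ge0 (G t) (p - 1).
apply: (le_trans (ler_wpM2r Gp Fm)).
rewrite -[leLHS]mulrA; apply: (@le_trans _ _ (rho ^+ n * (al * be `^ (p - 1) / ga `^ p * t ^+ n))).
  by apply: ler_wpM2l mG; apply: exprn_ge0; exact: ltW.
rewrite mulrCA -exprMn (_ : rho * t = (s + (p - 1) * t) / p)//.
by rewrite /rho; field; rewrite !gt_eqF.
Qed.

Hypothesis PL : forall s : R, 0 < s ->
  F s * G s `^ (p - 1) = al * be `^ (p - 1) / ga `^ p * s ^+ n.

(** At equal heights the dilation ratio is [1], so [{Phi <= s}] sits inside [{N <= 1}], whose volume
    is no larger by [PL]. The points with [N < 1] and [Phi > s] form an open set, as [N] is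
    continuous and [Phi] lower semicontinuous; if nonempty it would add volume. *)
Lemma level_extremal (s : R) : 0 < s -> exists N : 'rV[R]_n -> R,
  [/\ forall (c : R) x, 0 <= c -> N (c *: x) = c * N x,
   forall x, N x < 1 -> (Phi x <= s%:E)%E &
   forall (r : R) x, (Phi x <= r%:E)%E -> N x <= (r + (p - 1) * s) / (p * s)].
Proof.
move=> s0; have [N [m1 [cN N_hom m1E NP /(level_bound _ _ s0) mG]]] := comparison s s0.
exists N; split=> // x0 Nx0; rewrite leNgt; apply/negP => Phix0.
have [G0 _ _] := dual_cdf cPhi Phi0.
have [_ FE _] := classC_cdf cPhi Phi0.
have m1F : m1 <= F s.
  by move: mG; rewrite -PL// ler_pM2r// powR_gt0// G0.
pose U := (N @^-1` `]-oo, 1[%classic) `&` [set x | (s%:E < Phi x)%E].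
have oU : open U.
  apply: openI.
    by apply: open_comp => // x _; exact: cN.
  by have /lower_semicontinuousP := classC_lsc cPhi; apply.
have U0 : (0 < mu U)%E.
  apply: lebesgue_rV_open_gt0 => //; exists x0; split => //=.
have mPhi : measurable [set x | (Phi x <= s%:E)%E].
  by apply: measurable_sublevel; apply: lsc_measurable_rV; exact: (classC_lsc cPhi).
have mU := open_measurable_rV _ _ oU.
have muU : mu ([set x | (Phi x <= s%:E)%E] `|` U) =
    (mu [set x | (Phi x <= s%:E)%E] + mu U)%E.
  apply: measureU => //.
  by apply/seteqP; split=> x // [/= h [_ /= /lt_geF]]; rewrite h.
have : (mu [set x | (Phi x <= s%:E)%E] + mu U <= mu [set x | (N x <= 1)%R])%E.
  rewrite -muU.
  apply: le_measure; rewrite ?inE; [exact: measurableU|exact: measurable_le1|].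
  move=> x [/NP|[/=]]; last by rewrite in_itv/= => /ltW.
  rewrite (_ : _ / _ = 1) => //; rewrite -{1}(mul1r s) -mulrDl subrKC divff//.
  by rewrite gt_eqF// mulr_gt0.
rewrite m1E (FE _ s0) => h.
have := le_trans h (_ : (m1%:E <= (F s)%:E)%E).
rewrite lee_fin => /(_ m1F).
by rewrite -[leRHS]adde0 leeD2lE// leNgt U0.
Qed.

Lemma level_step (s t r : R) x : 0 < s -> 0 < t -> (Phi x <= s%:E)%E ->
  0 <= r < p * t / (s + (p - 1) * t) -> (Phi (r *: x) <= t%:E)%E.
Proof.
move=> s0 t0 xs /andP[r0 rlt].
have [N [N_hom N1 NP]] := level_extremal _ t0.
have u0 : 0 < s + (p - 1) * t by rewrite addr_gt0// mulr_gt0.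
have pt0 : 0 < p * t by rewrite mulr_gt0.
apply: N1; rewrite N_hom//.
apply: (le_lt_trans (ler_wpM2l r0 (NP _ _ xs))).
by rewrite mulrA ltr_pdivrMr// mul1r -ltr_pdivlMr.
Qed.

End comparison.

End maximizer.

(** * From inclusions between levels to homogeneity *)

Section homogeneity.
Context {R : realType} {n : nat}.
Implicit Type Phi : 'rV[R]_n -> \bar R.

(** Inverting [1 - y <= expR (- y)] gives [(1 - y)^-1], which stays below the quadratic while
    [y <= 1 / 2]. *)
Lemma expR_le_quadratic (y : R) : y <= 2^-1 -> expR y <= 1 + y + 2 * y ^+ 2.
Proof.
move=> y2; have y1 : 0 < 1 - y by lra.
have e1 : 1 - y <= expR (- y) by exact: expR_ge1Dx.
have e2 : expR y <= (1 - y)^-1.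
  by rewrite -[leLHS]invrK -expRN lef_pV2// posrE expR_gt0.
apply: (le_trans e2); rewrite -[leLHS]mul1r ler_pdivrMr//.
rewrite (_ : (1 + y + 2 * y ^+ 2) * (1 - y) = 1 + y ^+ 2 * (1 - 2 * y)); last by ring.
by rewrite lerDl mulr_ge0 ?sqr_ge0//; lra.
Qed.

(* To first order in 1/m, [r^(1/m) < p tau / (1 + (p - 1) tau)] with
   [tau = sg^(1/m)] reads [p ln r < ln sg]. *)
Lemma exists_root_lt (p r sg : R) : 1 < p -> 0 < r -> r `^ p < sg ->
  exists (m : nat) (q tau : R), [/\ 0 < tau, q ^+ m = r, tau ^+ m = sg &
    0 <= q < p * tau / (1 + (p - 1) * tau)].
Proof.
move=> p1 r0 rsg.
have sg0 : 0 < sg by apply: le_lt_trans rsg; exact: powR_ge0.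
pose L := ln r; pose Z := ln sg.
have LZ : 0 < Z - p * L by rewrite subr_gt0 -ln_powR ltr_ln ?posrE ?powR_gt0.
(* With [l = L / m] and [z = Z / m], the goal divided by [expR z] reads
   [e^(l - z) + (p - 1) e^l < p]; the quadratic bound of the left side is
   [p - (Z - p L) / m + 2 K / m^2]. *)
pose K := (L - Z) ^+ 2 + (p - 1) * L ^+ 2.
have K0 : 0 <= K.
  apply: addr_ge0; first exact: sqr_ge0.
  by apply: mulr_ge0; [rewrite subr_ge0 ltW|exact: sqr_ge0].
(* Any [m > B] keeps [|l|] and [|l - z|] at most [1 / 2] and [2 K / m] below [Z - p L]. *)
pose B := 2 * `|L| + 2 * `|L - Z| + 2 * K / (Z - p * L).
pose m := (Num.truncn B).+1.
have Bm : B < m%:R by exact: truncnS_gt.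
have m0 : 0 < m%:R :> R by rewrite ltr0n.
have KZ0 : 0 <= 2 * K / (Z - p * L) by rewrite divr_ge0 ?mulr_ge0// ltW.
have aL : `|L| <= m%:R / 2 by have := normr_ge0 (L - Z); move: Bm; rewrite /B; lra.
have aLZ : `|L - Z| <= m%:R / 2 by have := normr_ge0 L; move: Bm; rewrite /B; lra.
have Km : 2 * K < m%:R * (Z - p * L).
  rewrite -ltr_pdivrMr//; have := normr_ge0 L; have := normr_ge0 (L - Z).
  by move: Bm; rewrite /B; lra.
pose l := L / m%:R; pose z := Z / m%:R.
have lE : m%:R * l = L by rewrite /l mulrC divfK// gt_eqF.
have zE : m%:R * z = Z by rewrite /z mulrC divfK// gt_eqF.
exists m, (expR l), (expR z); split.
- exact: expR_gt0.
- by rewrite -expRM_natl lE lnK.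
- by rewrite -expRM_natl zE lnK.
have ez0 := expR_gt0 z; have el0 := expR_gt0 l.
have D0 : 0 < 1 + (p - 1) * expR z by rewrite addr_gt0// mulr_gt0// subr_gt0.
rewrite (ltW el0)/= ltr_pdivlMr//.
have -> : expR l * (1 + (p - 1) * expR z) =
    (expR (l - z) + (p - 1) * expR l) * expR z.
  have elE : expR l = expR (l - z) * expR z by rewrite -expRD subrK.
  by rewrite [RHS]mulrDl -elE; ring.
rewrite ltr_pM2r//.
have l2 : l <= 2^-1.
  by rewrite /l ler_pdivrMr// mulrC; have := ler_norm L; lra.
have lz2 : l - z <= 2^-1.
  by rewrite /l /z -mulrBl ler_pdivrMr// mulrC; have := ler_norm (L - Z); lra.
have b1 := expR_le_quadratic _ lz2.
have b2 : (p - 1) * expR l <= (p - 1) * (1 + l + 2 * l ^+ 2).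
  by rewrite ler_wpM2l ?expR_le_quadratic// subr_ge0 ltW.
have E : (1 + (l - z) + 2 * (l - z) ^+ 2) + (p - 1) * (1 + l + 2 * l ^+ 2) =
    p + (2 * K - m%:R * (Z - p * L)) / m%:R ^+ 2.
  by rewrite /l /z /K; field; rewrite gt_eqF.
have : (2 * K - m%:R * (Z - p * L)) / m%:R ^+ 2 < 0.
  by rewrite pmulr_llt0 ?subr_lt0// invr_gt0 exprn_gt0.
by lra.
Qed.

Lemma level_step_homogeneous Phi (p : R) : 1 < p -> Phi 0 = 0%E ->
  (forall x, (0 <= Phi x)%E) ->
  (forall (s t r : R) x, 0 < s -> 0 < t -> (Phi x <= s%:E)%E ->
    0 <= r < p * t / (s + (p - 1) * t) -> (Phi (r *: x) <= t%:E)%E) ->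
  p_homogeneous p Phi.
Proof.
move=> p1 Phi0 Phi_ge0 step.
(* The admissible factor depends on the heights only through [tau = t / s], so the step repeats
   along the heights [tau^k s]. *)
have iter (m : nat) (q tau s : R) x : 0 < tau -> 0 < s ->
    0 <= q < p * tau / (1 + (p - 1) * tau) -> (Phi x <= s%:E)%E ->
    (Phi (q ^+ m *: x) <= (tau ^+ m * s)%:E)%E.
  move=> tau0 s0 q_lt; elim: m x s s0 => [|m IH] x s s0 xs.
    by rewrite !expr0 scale1r mul1r.
  rewrite !exprSr -scalerA -mulrA; apply: IH; first by rewrite mulr_gt0.
  apply: (step s) => //; first by rewrite mulr_gt0.
  suff <- : p * tau / (1 + (p - 1) * tau) = p * (tau * s) / (s + (p - 1) * (tau * s)) by [].
  have D0 : 0 < 1 + (p - 1) * tau by rewrite addr_gt0// mulr_gt0// subr_gt0.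
  have -> : s + (p - 1) * (tau * s) = s * (1 + (p - 1) * tau) by ring.
  by field; rewrite !gt_eqF.
have le1 (r sg s : R) x : 0 < r -> r `^ p < sg -> 0 < s -> (Phi x <= s%:E)%E ->
    (Phi (r *: x) <= (sg * s)%:E)%E.
  move=> r0 rsg s0 xs.
  have [m [q [tau [tau0 <- <- q_lt]]]] := exists_root_lt _ _ _ p1 r0 rsg.
  exact: iter.
have le2 (r : R) x : 0 < r -> (Phi (r *: x) <= (r `^ p)%:E * Phi x)%E.
  move=> r0; have rp0 : 0 < r `^ p by exact: powR_gt0.
  have := Phi_ge0 x; case Phix : (Phi x) => [v| |]// v0; last first.
    by rewrite gt0_muley ?lte_fin// leey.
  rewrite lee_fin in v0; apply/lee_addgt0Pr => e e0; rewrite -EFinM -EFinD.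
  (* [le1] needs a positive height and a ratio strictly above [r^p], so both are raised by [d]; as
     [d <= 1], [(r^p + d) (v + d) <= r^p v + d K]. *)
  pose K := r `^ p + v + 1.
  have K0 : 0 < K by rewrite /K; lra.
  pose d := Num.min 1 (e / K).
  have d0 : 0 < d by rewrite lt_min ltr01 divr_gt0.
  have d1 : d <= 1 by rewrite ge_min lexx.
  have dK : d * K <= e by rewrite -ler_pdivlMr// ge_min lexx orbT.
  have := @le1 r (r `^ p + d) (v + d) x r0.
  rewrite ltrDl Phix lee_fin lerDl (ltW d0) => /(_ d0 _ isT) h.
  have vd : 0 < v + d by lra.
  apply: (le_trans (h vd)); rewrite lee_fin.
  have dd : d * d <= d by rewrite ger_pMr.
  by rewrite /K in dK; lra.
move=> r x; rewrite le_eqVlt => /predU1P[<-|r0].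
  by rewrite scale0r Phi0 powR0 ?mul0e// gt_eqF//; lra.
apply/eqP; rewrite eq_le le2//=.
(* The reverse inequality is [le2] for [r^-1] at the point [r x]. *)
have ri : 0 < r^-1 by rewrite invr_gt0.
have := le2 r^-1 (r *: x) ri.
rewrite scalerA mulVf ?gt_eqF// scale1r => h.
by rewrite -(@lee_pdivlMl R (r `^ p)) ?powR_gt0// -powRV ?(ltW r0).
Qed.

End homogeneity.

(** * Prekopa-Leindler applied to the volume profiles *)

Lemma Ck_on_le {R : realType} {n : nat} (U : set 'rV[R]_n) (f : 'rV[R]_n -> R) (k : nat) :
  Ck_on k.+1 U f -> Ck_on k U f.
Proof.
elim: k f => [|k IH] f [cf df]; split=> // i.
by have [ddf /IH] := df i.
Qed.

Theorem theorem2 (R : realType) (n : nat) (p : R) (V : 'rV[R]_n -> R)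
    (Phi : 'rV[R]_n -> \bar R) :
  1 < p ->
  even_fun V ->
  strictly_convex V ->
  p_homogeneous p (fun x => (V x)%:E) ->
  Ck_on 3 (~` [set 0]) V ->
  classC Phi ->
  (forall Psi : 'rV[R]_n -> \bar R, classC Psi -> (BS p V Psi <= BS p V Phi)%E) ->
  Phi 0 = 0%E ->
  p_homogeneous p Phi.
Proof.
move=> p1 V_even V_sc V_hom /Ck_on_le /Ck_on_le V_C1 cPhi Phi_max Phi0.
have p0 : 0 < p by lra.
have p10 : 0 < p - 1 by rewrite subr_gt0.
have [F0 _ [al [A [al0 alE dA [A01 A_to0 A_to1]]]]] := classC_cdf Phi cPhi Phi0.
have [G0 _ [be [B [be0 beE dB [B01 B_to0 B_to1]]]]] :=
  dual_cdf p V Phi p1 V_even V_sc V_hom V_C1 cPhi Phi0.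
have k0 : 0 <= n%:R / p by rewrite divr_ge0// ltW.
have [ga [H [ga0 gaE dH [H01 _ _]]]] := powR_cdf (n%:R / p) k0.
have lvl := level_inequality p V Phi p1 V_even V_sc V_hom V_C1 cPhi Phi0 Phi_max
  al be ga ga0 alE beE gaE.
pose F (s : R) := fine (lebesgue_rV R n [set x | (Phi x <= s%:E)%E]).
pose G (s : R) := fine (lebesgue_rV R n
  [set y | (((p - 1)^-1)%:E * legendre Phi (grad V y) <= s%:E)%E]).
have {}F0 (s : R) : 0 < s -> 0 < F s := F0 s.
have {}G0 (s : R) : 0 < s -> 0 < G s := G0 s.
have {}lvl (s t : R) : 0 < s -> 0 < t -> F s * G t `^ (p - 1) <=
    al * be `^ (p - 1) / ga `^ p * ((s + (p - 1) * t) / p) ^+ n := lvl s t.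
pose lam := p^-1.
have lam0 : 0 < lam by rewrite invr_gt0.
have lam01 : 0 < lam < 1 by rewrite lam0 invf_lt1.
have plam : p * lam = 1 by rewrite divff// gt_eqF.
have plamB : p * (1 - lam) = p - 1 by rewrite mulrBr plam mulr1.
have gap0 : 0 < ga `^ p by exact: powR_gt0.
pose f (s : R) := expR (- s) * F s / al.
pose g (s : R) := expR (- s) * G s / be.
pose h (s : R) := expR (- s) * s `^ (n%:R / p) / ga.
have f0 (s : R) : 0 < s -> 0 < f s by move=> /F0 ?; rewrite divr_gt0// mulr_gt0// expR_gt0.
have g0 (s : R) : 0 < s -> 0 < g s by move=> /G0 ?; rewrite divr_gt0// mulr_gt0// expR_gt0.
have h0 (s : R) : 0 < s -> 0 < h s.
  by move=> s0; rewrite divr_gt0// mulr_gt0 ?expR_gt0// powR_gt0.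
have expRp (s q : R) : expR (- s) `^ q = expR (- (q * s)).
  by rewrite -expRM mulNr mulrC.
have hp (s : R) : 0 < s -> h s `^ p = expR (- (p * s)) * s ^+ n / ga `^ p.
  move=> s0; rewrite /h !powRM ?powRV ?mulr_ge0 ?powR_ge0 ?expR_ge0 ?invr_ge0 ?(ltW ga0)//.
  by rewrite expRp -powRrM divfK ?gt_eqF// powR_mulrn ?(ltW s0).
(* The power [p] turns the weights [1 / p] and [1 - 1 / p] into the exponents [1] and [p - 1] of
   [level_inequality], and the normalisations of the three densities into its constant. *)
have fgp (s t : R) : 0 < s -> 0 < t -> (f s `^ lam * g t `^ (1 - lam)) `^ p =
    expR (- (s + (p - 1) * t)) * (F s * G t `^ (p - 1)) / (al * be `^ (p - 1)).
  move=> s0 t0; rewrite powRM ?powR_ge0// -!powRrM ![_ * p]mulrC plam plamB.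
  rewrite powRr1 ?(ltW (f0 _ s0))// /g.
  rewrite !powRM ?powRV ?mulr_ge0 ?expR_ge0 ?invr_ge0 ?(ltW be0) ?(ltW (G0 _ t0))//.
  rewrite expRp opprD expRD /f.
  by field; rewrite !gt_eqF// powR_gt0.
have fgh (s t : R) : 0 < s -> 0 < t -> f s `^ lam * g t `^ (1 - lam) <= h (lam * s + (1 - lam) * t).
  move=> s0 t0; set u := lam * s + _.
  have lam10 : 0 < 1 - lam by rewrite subr_gt0; case/andP: lam01.
  have u0 : 0 < u by rewrite addr_gt0// mulr_gt0.
  have uE : u = (s + (p - 1) * t) / p.
    by rewrite mulrDl -plamB /u /lam; field; rewrite gt_eqF.
  rewrite leNgt; apply/negP => /(gt0_ltr_powR p0).
  rewrite !nnegrE (ltW (h0 _ u0)) mulr_ge0 ?powR_ge0// => /(_ isT isT).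
  apply/negP; rewrite -leNgt fgp// hp//.
  have -> : s + (p - 1) * t = p * u by rewrite uE [RHS]mulrC divfK// gt_eqF.
  rewrite -!mulrA ler_pM2l ?expR_gt0// mulrA ler_pdivrMr ?mulr_gt0 ?powR_gt0//.
  apply: (le_trans (lvl _ _ s0 t0)).
  by rewrite -uE le_eqVlt; apply/orP; left; apply/eqP; field; rewrite gt_eqF.
have PLeq (s : R) : 0 < s -> f s `^ lam * g s `^ (1 - lam) = h s.
  exact: (prekopa_leindler_cdf_eq A B H f g h lam lam01 dA dB dH f0 g0 A01 B01 H01
    A_to0 A_to1 B_to0 B_to1 fgh).
have PL (s : R) : 0 < s -> F s * G s `^ (p - 1) = al * be `^ (p - 1) / ga `^ p * s ^+ n.
  move=> s0; have /(congr1 (fun x => x `^ p)) := PLeq _ s0.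
  rewrite fgp// hp// (_ : s + (p - 1) * s = p * s); last by ring.
  rewrite -!mulrA => /(mulfI (lt0r_neq0 (expR_gt0 _))) E.
  have ab0 : 0 < al * be `^ (p - 1) by rewrite mulr_gt0// powR_gt0.
  apply: (mulIf (invr_neq0 (lt0r_neq0 ab0))).
  rewrite -[LHS]mulrA E.
  by field; rewrite !gt_eqF// powR_gt0.
apply: (level_step_homogeneous Phi p p1 Phi0 (classC_ge0 Phi cPhi Phi0)).
move=> s t r x.
exact: (level_step p V Phi p1 V_even V_sc V_hom V_C1 cPhi Phi0 Phi_max
  al be ga ga0 alE beE gaE PL).
Qed.
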